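(* Let $(R,\mathfrak m)$ be a Gorenstein local ring of dimension $d>1$, and let $M$ be a finitely generated $R$-module with $\dim M=1$. Then $\mathrm{Ann}_R\big(\mathrm{Ext}^{d-1}_R(M,R)\big)=\mathrm{Ann}_R\big(M/\Gamma_{\mathfrak m}(M)\big)$. In particular, $\mathrm{Ann}_R\big(H^1_{\mathfrak m}(M)\big)=\mathrm{Ann}_R\big(M/\Gamma_{\mathfrak m}(M)\big)$.
   Context: $\Gamma_{\mathfrak m}(M)$ is the submodule of elements of $M$ annihilated by some power of $\mathfrak m$, and $H^i_{\mathfrak m}$ denotes local cohomology with support in $\mathfrak m$. *)

(* Defs.v *)
From HB Require Import structures.
From mathcomp Require Import all_boot all_algebra.
From mathcomp Require Import boolp.

Set Implicit Arguments.
Unset Strict Implicit.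
Unset Printing Implicit Defensive.

Import GRing.Theory.
Local Open Scope ring_scope.
Local Open Scope quotient_scope.

Section Submodule.
Variables (R : nzRingType) (V : lmodType R).

(* [submodClosed V] does not carry closure under opposite, which the
   additive quotient and the subtype construction both ask for. *)
Definition submod_pred (S : submodClosed V) : {pred V} := fun x => x \in S.

HB.instance Definition _ (S : submodClosed V) :=
  GRing.isSubmodClosed.Build R V (submod_pred S) (GRing.subsemimodClosedP S).

Definition submod (S : submodClosed V) := {x : V | x \in submod_pred S}.

HB.instance Definition _ S := SubChoice.on (submod S).
HB.instance Definition _ S := [SubChoice_isSubLmodule of submod S by <:].

End Submodule.

Section QuotientModule.
Variables (R : nzRingType) (V : lmodType R) (S : submodClosed V).

Definition quotmod := Quotient.quot (submod_pred S).
HB.instance Definition _ := GRing.Zmodule.on quotmod.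

Definition quotmod_pi (x : V) : quotmod := \pi_(Quotient.quot (submod_pred S)) x.

Definition quotmod_repr (u : quotmod) : V :=
  @repr V (Quotient.quot (submod_pred S)) u.

Definition quotmod_scale (a : R) (u : quotmod) : quotmod :=
  quotmod_pi (a *: quotmod_repr u).

Lemma quotmod_reprK : cancel quotmod_repr quotmod_pi.
Proof. exact: reprK. Qed.

Lemma quotmod_pi_eq x y : (quotmod_pi x == quotmod_pi y) = (x - y \in S).
Proof. by rewrite -Quotient.idealrBE. Qed.

Lemma quotmod_piD : {morph quotmod_pi : x y / x + y}.
Proof. by move=> x y; rewrite /quotmod_pi raddfD. Qed.

Lemma quotmod_scale_pi a (x : V) :
  quotmod_scale a (quotmod_pi x) = quotmod_pi (a *: x).
Proof.
apply/eqP; rewrite quotmod_pi_eq -scalerBr rpredZ //.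
by rewrite -quotmod_pi_eq quotmod_reprK.
Qed.

Lemma quotmod_scaleA a b u :
  quotmod_scale a (quotmod_scale b u) = quotmod_scale (a * b) u.
Proof. by rewrite -[u]quotmod_reprK !quotmod_scale_pi scalerA. Qed.

Lemma quotmod_scale1 : left_id 1 quotmod_scale.
Proof. by move=> u; rewrite -[u]quotmod_reprK quotmod_scale_pi scale1r. Qed.

Lemma quotmod_scaleDr : right_distributive quotmod_scale +%R.
Proof.
move=> a u v; rewrite -[u]quotmod_reprK -[v]quotmod_reprK -quotmod_piD.
by rewrite !quotmod_scale_pi scalerDr quotmod_piD.
Qed.

Lemma quotmod_scaleDl u : {morph quotmod_scale^~ u : a b / a + b}.
Proof.
by move=> a b; rewrite -[u]quotmod_reprK !quotmod_scale_pi scalerDl quotmod_piD.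
Qed.

HB.instance Definition _ := GRing.Zmodule_isLmodule.Build R quotmod
  quotmod_scaleA quotmod_scale1 quotmod_scaleDr quotmod_scaleDl.

End QuotientModule.

Section Hom.
Variables (R : comNzRingType) (U V : lmodType R).

Definition Hom := {linear U -> V}.
HB.instance Definition _ := gen_eqMixin Hom.
HB.instance Definition _ := gen_choiceMixin Hom.

Lemma Hom_ext (f g : Hom) : (f : U -> V) =1 g -> f = g.
Proof.
case: f => f [[fD] [fZ]]; case: g => g [[gD] [gZ]] /= /funext fg; subst g.
by rewrite (Prop_irrelevance fD gD) (Prop_irrelevance fZ gZ).
Qed.

Definition Hom_zero : Hom := (\0 : {linear U -> V}).
Definition Hom_opp (f : Hom) : Hom := (\- f : {linear U -> V}).
Definition Hom_add (f g : Hom) : Hom := (f \+ g : {linear U -> V}).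
Definition Hom_scale (a : R) (f : Hom) : Hom := (a \*: f : {linear U -> V}).

Lemma Hom_addA : associative Hom_add.
Proof. by move=> f g h; apply: Hom_ext => x /=; rewrite addrA. Qed.
Lemma Hom_addC : commutative Hom_add.
Proof. by move=> f g; apply: Hom_ext => x /=; rewrite addrC. Qed.
Lemma Hom_add0 : left_id Hom_zero Hom_add.
Proof. by move=> f; apply: Hom_ext => x /=; rewrite add0r. Qed.
Lemma Hom_addN : left_inverse Hom_zero Hom_opp Hom_add.
Proof. by move=> f; apply: Hom_ext => x /=; rewrite addNr. Qed.

HB.instance Definition _ :=
  GRing.isZmodule.Build Hom Hom_addA Hom_addC Hom_add0 Hom_addN.

Lemma Hom_scaleA a b f : Hom_scale a (Hom_scale b f) = Hom_scale (a * b) f.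
Proof. by apply: Hom_ext => x /=; rewrite scalerA. Qed.
Lemma Hom_scale1 : left_id 1 Hom_scale.
Proof. by move=> f; apply: Hom_ext => x /=; rewrite scale1r. Qed.
Lemma Hom_scaleDr : right_distributive Hom_scale +%R.
Proof. by move=> a f g; apply: Hom_ext => x /=; rewrite scalerDr. Qed.
Lemma Hom_scaleDl f : {morph Hom_scale^~ f : a b / a + b}.
Proof. by move=> a b; apply: Hom_ext => x /=; rewrite scalerDl. Qed.

HB.instance Definition _ := GRing.Zmodule_isLmodule.Build R Hom
  Hom_scaleA Hom_scale1 Hom_scaleDr Hom_scaleDl.

End Hom.

Section HomPrecomp.
Variables (R : comNzRingType) (U V N : lmodType R) (f : {linear U -> V}).

Definition Hom_precomp (g : Hom V N) : Hom U N := (g \o f : {linear U -> N}).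

Lemma Hom_precomp_is_linear : linear Hom_precomp.
Proof. by move=> a g h; apply: Hom_ext. Qed.

HB.instance Definition _ :=
  GRing.isLinear.Build R (Hom V N) (Hom U N) *:%R Hom_precomp
    Hom_precomp_is_linear.

End HomPrecomp.
Arguments Hom_precomp {R U V} N f g.

Section Ideals.
Variable R : comNzRingType.
Implicit Types I J p : {pred R}.

(* The library's [idealr_closed] includes properness, [submod_closed] in the
   regular module [R^o] does not. *)
Definition ideal I := submod_closed (I : {pred R^o}).
Definition prime_ideal p := idealr_closed p /\ prime_idealr_closed p.
Definition maximal_ideal p :=
  idealr_closed p /\
  forall I, idealr_closed I -> {subset p <= I} -> I =i p.

Definition ideal_mul I J : {pred R} := [pred x | `[< exists s : seq (R * R),
  {in s, forall ab, ab.1 \in I /\ ab.2 \in J} /\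
  x = \sum_(ab <- s) ab.1 * ab.2 >]].

Lemma ideal_mulP I J x :
  reflect (exists s : seq (R * R),
             {in s, forall ab, ab.1 \in I /\ ab.2 \in J} /\
             x = \sum_(ab <- s) ab.1 * ab.2)
          (x \in ideal_mul I J).
Proof. exact: asboolP. Qed.

Fixpoint ideal_exp I n : {pred R} :=
  if n is k.+1 then ideal_mul (ideal_exp I k) I else predT.

Definition generates (M : lmodType R) (s : seq M) (N : {pred M}) :=
  forall x, x \in N <->
    exists c : 'I_(size s) -> R, x = \sum_(i < size s) c i *: s`_i.

Definition fin_gen (M : lmodType R) := exists s : seq M, generates s predT.

Definition noetherian := forall I, ideal I ->
  exists s : seq R^o, generates s I.

Definition local_ring (m : {pred R}) :=
  maximal_ideal m /\ forall n, maximal_ideal n -> n =i m.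

(* Primes of [R / I] are encoded as primes of [R] containing [I], so that
   [dim_mod_ideal I d] says that [R / I] has Krull dimension [d]. *)
Definition prime_chain I n (c : nat -> {pred R}) :=
  (forall i, (i <= n)%N -> prime_ideal (c i) /\ {subset I <= c i}) /\
  (forall i, (i < n)%N ->
     {subset c i <= c i.+1} /\ ~ {subset c i.+1 <= c i}).

Definition dim_mod_ideal I d :=
  (exists c, prime_chain I d c) /\
  (forall n c, prime_chain I n c -> (n <= d)%N).

Definition ring_dim d := dim_mod_ideal (pred1 (0 : R)) d.

Definition Ann (M : lmodType R) : {pred R} :=
  [pred r | `[< forall x : M, r *: x = 0 >]].

Definition module_dim (M : lmodType R) d := dim_mod_ideal (Ann M) d.

End Ideals.

Section Complexes.
Variable R : comNzRingType.

Record cochain_complex := CochainComplex {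
  cc_obj :> nat -> lmodType R;
  cc_diff : forall n, {linear cc_obj n -> cc_obj n.+1};
  cc_diffK : forall n x, cc_diff n.+1 (cc_diff n x) = 0 }.

Variables (C : cochain_complex) (n : nat).

Definition cocycle : {pred C n} := [pred x | cc_diff C n x == 0].

Lemma cocycle_closed : subsemimod_closed cocycle.
Proof.
split; first split.
- by rewrite inE raddf0.
- move=> x y; rewrite !inE => /eqP dx /eqP dy.
  by rewrite raddfD /= dx dy addr0.
by move=> a x; rewrite !inE => /eqP dx; rewrite linearZ /= dx scaler0.
Qed.

HB.instance Definition _ :=
  GRing.isSubmodClosed.Build R (C n) cocycle cocycle_closed.

Definition cocycles : lmodType R := submod cocycle.

Definition cocycle_val (z : cocycles) : C n := \val (z : submod cocycle).

Lemma cocycle_val_is_linear : linear cocycle_val.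
Proof. by []. Qed.

HB.instance Definition _ :=
  GRing.isLinear.Build R cocycles (C n) *:%R cocycle_val cocycle_val_is_linear.

End Complexes.
Arguments cocycle {R} C n.

Section Cohomology.
Variables (R : comNzRingType) (C : cochain_complex R).

(* In degree 0 the incoming differential is the zero map. *)
Definition is_coboundary n : C n -> Prop :=
  match n return C n -> Prop with
  | 0 => fun x => x = 0
  | k.+1 => fun x => exists y, x = cc_diff C k y
  end.

Definition coboundary n : {pred cocycles C n} :=
  [pred x | `[< is_coboundary (cocycle_val x) >]].

Lemma coboundaryP n (x : cocycles C n) :
  reflect (is_coboundary (cocycle_val x)) (x \in @coboundary n).
Proof. exact: asboolP. Qed.

Lemma coboundary_closed n : subsemimod_closed (@coboundary n).
Proof.
case: n => [|n]; (split; first split).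
- by apply/coboundaryP; exact: raddf0.
- move=> x y /coboundaryP /= x0 /coboundaryP /= y0; apply/coboundaryP.
  by rewrite /= raddfD /= x0 y0 addr0.
- move=> a x /coboundaryP /= x0; apply/coboundaryP.
  by rewrite /= linearZ /= x0 scaler0.
- by apply/coboundaryP; exists 0; rewrite !raddf0.
- move=> x y /coboundaryP[u xu] /coboundaryP[v yv]; apply/coboundaryP.
  by exists (u + v); rewrite !raddfD /= -xu -yv.
move=> a x /coboundaryP[u xu]; apply/coboundaryP.
by exists (a *: u); rewrite !linearZ /= -xu.
Qed.

HB.instance Definition _ n :=
  GRing.isSubmodClosed.Build R (cocycles C n) (@coboundary n)
    (@coboundary_closed n).

Definition cohomology n : lmodType R := quotmod (@coboundary n).

End Cohomology.

Section Resolutions.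
Variable R : comNzRingType.

Definition projective (P : lmodType R) :=
  forall (A B : lmodType R) (p : {linear A -> B}) (g : {linear P -> B}),
    (forall b, exists a, p a = b) ->
    exists h : {linear P -> A}, forall x, p (h x) = g x.

Definition injective_module (E : lmodType R) :=
  forall (A B : lmodType R) (i : {linear A -> B}) (g : {linear A -> E}),
    injective i -> exists h : {linear B -> E}, forall x, h (i x) = g x.

Record projective_resolution (M : lmodType R) := ProjectiveResolution {
  pr_obj :> nat -> lmodType R;
  pr_diff : forall n, {linear pr_obj n.+1 -> pr_obj n};
  pr_aug : {linear pr_obj 0 -> M};
  pr_proj : forall n, projective (pr_obj n);
  pr_aug_surj : forall y, exists x, pr_aug x = y;
  pr_exact0 : forall x, pr_aug x = 0 <-> exists y, pr_diff 0 y = x;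
  pr_exactS : forall n x,
    pr_diff n x = 0 <-> exists y, pr_diff n.+1 y = x }.

Record injective_resolution (M : lmodType R) := InjectiveResolution {
  ir_obj :> nat -> lmodType R;
  ir_diff : forall n, {linear ir_obj n -> ir_obj n.+1};
  ir_aug : {linear M -> ir_obj 0};
  ir_inj : forall n, injective_module (ir_obj n);
  ir_aug_inj : injective ir_aug;
  ir_exact0 : forall x, ir_diff 0 x = 0 <-> exists y, ir_aug y = x;
  ir_exactS : forall n x,
    ir_diff n.+1 x = 0 <-> exists y, ir_diff n y = x }.

Definition finite_injective_dimension (M : lmodType R) :=
  exists (I : injective_resolution M) (n : nat),
    forall k, (n < k)%N -> forall x : I k, x = 0.

Definition gorenstein_local_ring (m : {pred R}) :=
  [/\ noetherian R, local_ring m & finite_injective_dimension R^o].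

End Resolutions.

Section Ext.
Variables (R : comNzRingType) (M : lmodType R) (P : projective_resolution M).
Variable N : lmodType R.

Lemma hom_complex_diffK n (f : Hom (P n) N) :
  Hom_precomp N (pr_diff P n.+1) (Hom_precomp N (pr_diff P n) f) = 0.
Proof.
apply: Hom_ext => x /=.
have -> : pr_diff P n (pr_diff P n.+1 x) = 0.
  by apply: (proj2 (pr_exactS _)); exists x.
exact: raddf0.
Qed.

Definition hom_complex : cochain_complex R :=
  @CochainComplex R (fun n => Hom (P n) N)
    (fun n => Hom_precomp N (pr_diff P n)) hom_complex_diffK.

(* Ext^n_R(M, N), computed from an arbitrary projective resolution of [M]. *)
Definition Ext n : lmodType R := cohomology hom_complex n.

End Ext.

Section Torsion.
Variables (R : comNzRingType) (m : {pred R}).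

Definition torsion (M : lmodType R) : {pred M} :=
  [pred x | `[< exists n, {in ideal_exp m n, forall a, a *: x = 0} >]].
Arguments torsion : clear implicits.

Lemma torsionP (M : lmodType R) (x : M) :
  reflect (exists n, {in ideal_exp m n, forall a, a *: x = 0})
          (x \in torsion M).
Proof. exact: asboolP. Qed.

Lemma ideal_exp_mulr n a b : b \in ideal_exp m n -> a * b \in ideal_exp m n.
Proof.
case: n => [//|n].
elim: n a b => [|n IHn] a b /ideal_mulP[s [sI ->]]; apply/ideal_mulP;
  exists [seq (a * uv.1, uv.2) | uv <- s]; split.
- by move=> _ /mapP[uv /sI[? ?] ->].
- by rewrite big_map mulr_sumr; apply: eq_bigr => uv _; rewrite mulrA.
- by move=> _ /mapP[uv /sI[? ?] ->]; split=> //; apply: IHn.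
by rewrite big_map mulr_sumr; apply: eq_bigr => uv _; rewrite mulrA.
Qed.

Lemma ideal_exp_kill (M : lmodType R) (x : M) n k : (n <= k)%N ->
  {in ideal_exp m n, forall a, a *: x = 0} ->
  {in ideal_exp m k, forall a, a *: x = 0}.
Proof.
move=> /subnK <- xn; elim: (k - n)%N => [//|j IHj] a.
move=> /ideal_mulP[s [sI ->]]; rewrite scaler_suml big_seq big1 // => uv uvs.
by rewrite mulrC -scalerA IHj ?scaler0 //; case: (sI _ uvs).
Qed.

Lemma torsion_closed M : subsemimod_closed (torsion M).
Proof.
split; first split.
- by apply/torsionP; exists 0%N => a _; rewrite scaler0.
- move=> x y /torsionP[j xj] /torsionP[k yk]; apply/torsionP.
  exists (maxn j k) => a am; rewrite scalerDr.
  rewrite (ideal_exp_kill (leq_maxl j k) xj) //.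
  by rewrite (ideal_exp_kill (leq_maxr j k) yk) // addr0.
move=> a x /torsionP[n xn]; apply/torsionP; exists n => b bm.
by rewrite scalerA mulrC -scalerA xn // scaler0.
Qed.

HB.instance Definition _ M :=
  GRing.isSubmodClosed.Build R M (torsion M) (torsion_closed M).

Definition Gamma (M : lmodType R) : lmodType R := submod (torsion M).

Section GammaMap.
Variables (M N : lmodType R) (f : {linear M -> N}).

Lemma torsion_map x : x \in torsion M -> f x \in torsion N.
Proof.
move=> /torsionP[n xn]; apply/torsionP; exists n => a am.
by rewrite -linearZ xn // raddf0.
Qed.

Definition Gamma_map (x : Gamma M) : Gamma N :=
  exist _ (f (val x)) (torsion_map (valP x)).

Lemma Gamma_map_is_linear : linear Gamma_map.
Proof. by move=> a x y; apply: val_inj; rewrite /= linearP. Qed.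

HB.instance Definition _ :=
  GRing.isLinear.Build R (Gamma M) (Gamma N) *:%R Gamma_map
    Gamma_map_is_linear.

End GammaMap.

Variables (M : lmodType R) (I : injective_resolution M).

Lemma gamma_complex_diffK n (x : Gamma (I n)) :
  Gamma_map (ir_diff I n.+1) (Gamma_map (ir_diff I n) x) = 0.
Proof. by apply: val_inj; apply: (proj2 (ir_exactS _)); eexists. Qed.

Definition gamma_complex : cochain_complex R :=
  @CochainComplex R (fun n => Gamma (I n))
    (fun n => Gamma_map (ir_diff I n)) gamma_complex_diffK.

(* The n-th right derived functor of [Gamma] at [M], computed from an arbitrary
   injective resolution of [M]. *)
Definition local_cohomology n : lmodType R := cohomology gamma_complex n.

End Torsion.
Arguments torsion {R} m M.

(* Main.v *)
Require Import Defs.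
From HB Require Import structures.
From mathcomp Require Import all_boot all_algebra.
From mathcomp Require Import boolp ring.
From Stdlib Require List.
Import GRing.Theory.
Import Defs.
Set Implicit Arguments.
Unset Strict Implicit.
Unset Printing Implicit Defensive.
Local Open Scope ring_scope.

(** Write N for M / Gamma_m(M). Because dim M = 1, prime avoidance gives an
    element x of m that lies in no prime containing Ann M other than m, so a
    power of every element of m lies in Ann M + (x). Such an x is a nonzero
    divisor on N, and every N / x^j N has finite length. By an easy case of
    Krull's intersection theorem the submodules x^j N meet in 0, so a scalar a
    satisfies aM <= Gamma_m(M) as soon as it kills N / x^j N for all j. Both
    assertions are reduced to this criterion.

    Ext side. Let T^i = Ext^i(-, R), computed from a finite injective resolution
    E of R. A short exact sequence of modules gives a long exact sequence because
    every E^i is injective, T^i kills projectives for i > 0, and T^i of a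
    finitely generated module is noetherian. Let n be the largest i with
    T^i(R/m) <> 0. Nakayama's lemma and devissage show that T^i vanishes on
    finitely generated modules for i > n, and then that T^n is nonzero on every
    module containing R/m.
    - There is a regular sequence of length n in m: if m had no nonzero divisor
      on R/J, with J generated by s < n regular elements, then R/m would embed in
      R/J and T^n(R/J) <> 0, whereas T^j(R/J) = 0 for j <> s by the Koszul
      recursion ([perfect_grade_step], [regseq_exists]).
    - For J generated by a regular sequence of length n, T^n(R/J) is isomorphic
      to R/J. Multiplication by a high power of an element of m on R/J factors
      through a module on which T^n vanishes, so that power lies in J
      ([regseq_radical]): R/J has finite length. Presenting R/m as a quotient of
      R/J then gives T^i(R/m) = 0, hence T^i = 0 on modules of finite length,
      for all i < n ([low_vanish]).
    - n = d ([dim_eq]): a regular sequence of length n produces a chain of n + 1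
      primes, and along a saturated chain of primes p_0 < ... < p_d an element of
      T^i(R/p_i) with annihilator p_i can be moved to one of T^(i+1)(R/p_(i+1))
      (Bass), so that T^d does not vanish.
    Consequently T^d is exact and faithful on modules of finite length. Since
    T^(d-2) and T^(d-1) vanish on Gamma_m(M), the annihilators of T^(d-1)(M) and
    T^(d-1)(N) agree; as T^d(N) = 0, the module T^(d-1)(N) maps onto
    T^d(N / x^j N) for every j. So a scalar killing T^(d-1)(M) kills every
    N / x^j N ([ann_top_minus_one]). Conversely, when aM <= Gamma_m(M),
    multiplication by a on M factors through Gamma_m(M), on which T^(d-1) is 0.
    The comparison with Ext computed from a projective resolution is by dimension
    shifting along its syzygies ([ann_Ext_balance]).

    Local cohomology side ([ann_H1]). For an injective resolution I of M, a class
    in H^1_m(M) comes from some y in I^0 whose differential is m-torsion. If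
    aM <= Gamma_m(M) then ay is itself m-torsion. Conversely, by injectivity the
    map x^j v |-> x^K v on x^j M extends to M -> I^0, and its values y on M give
    classes whose annihilation by a forces a x^K M into x^j M + Gamma_m(M). *)

(** * Submodules, exact sequences and noetherian modules *)

Section Modules.
Variable R : comNzRingType.

Definition submodule (V : lmodType R) (P : V -> Prop) :=
  P 0 /\ forall a x y, P x -> P y -> P (a *: x + y).

Section SubmTheory.
Variables (V : lmodType R) (P : V -> Prop) (hP : submodule P).
Lemma submoduleZ a x : P x -> P (a *: x).
Proof. by move=> px; rewrite -[_ *: _]addr0; apply: hP.2 => //; apply: hP.1. Qed.
Lemma submoduleD x y : P x -> P y -> P (x + y).
Proof. by move=> px py; rewrite -[x]scale1r; apply: hP.2. Qed.
Lemma submoduleN x : P x -> P (- x).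
Proof. by move=> px; rewrite -scaleN1r; apply: submoduleZ. Qed.
Lemma submoduleB x y : P x -> P y -> P (x - y).
Proof. by move=> px py; apply: submoduleD => //; apply: submoduleN. Qed.
End SubmTheory.

(** The module constructions ask for a bundled boolean predicate; classically
    every propositional submodule has one. *)
Lemma submodule_bundle (V : lmodType R) (P : V -> Prop) : submodule P ->
  exists S : submodClosed V, forall x, x \in S <-> P x.
Proof.
move=> hP; pose S : {pred V} := [pred x | `[< P x >]].
have hS : submod_closed S.
  split; first by apply/asboolP; exact: hP.1.
  by move=> a x y /asboolP px /asboolP py; apply/asboolP; exact: hP.2.
pose mix := GRing.isSubmodClosed.Build R V S hS.
pose C : submodClosed V := HB.pack S mix.
by exists C => x; split=> [/asboolP|px] //; apply/asboolP.
Qed.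

Definition inj_linear (U V : lmodType R) (f : {linear U -> V}) :=
  forall x, f x = 0 -> x = 0.
Definition surj_linear (U V : lmodType R) (f : {linear U -> V}) :=
  forall y, exists x, f x = y.
Definition exact_at (U V W : lmodType R) (f : {linear U -> V})
  (g : {linear V -> W}) := forall y, g y = 0 <-> exists x, f x = y.
Definition short_exact (A B C : lmodType R) (i : {linear A -> B})
  (p : {linear B -> C}) := [/\ inj_linear i, surj_linear p & exact_at i p].

Lemma inj_linearP (U V : lmodType R) (f : {linear U -> V}) : inj_linear f ->
  injective f.
Proof. by move=> fi x y fxy; apply/subr0_eq/fi; rewrite raddfB /= fxy subrr. Qed.

Lemma inj_linearI (U V : lmodType R) (f : {linear U -> V}) : injective f ->
  inj_linear f.
Proof. by move=> fi x fx; apply: fi; rewrite fx raddf0. Qed.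

(** Submodules and quotients are only ever used through an injection, or a
    surjection, with prescribed image or kernel, so the concrete types stay
    hidden behind an existential. *)
Lemma sub_exists (V : lmodType R) (P : V -> Prop) : submodule P ->
  exists (A : lmodType R) (i : {linear A -> V}),
    inj_linear i /\ forall v, P v <-> exists a, i a = v.
Proof.
move=> /submodule_bundle[S hS]; pose j : submod S -> V := fun x => \val x.
have jl : linear j by [].
pose mix := GRing.isLinear.Build R (submod S) V *:%R j jl.
pose i : {linear submod S -> V} := HB.pack j mix.
exists (submod S), i; split.
  by apply: inj_linearI => x y; apply: val_inj.
move=> v; split=> [/hS vS|[a <-]]; first by exists (exist _ v vS).
by apply/hS; exact: (valP a).
Qed.

Lemma quotmod_pi_linear (V : lmodType R) (S : submodClosed V) :
  linear (@quotmod_pi R V S).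
Proof. by move=> a x y; rewrite quotmod_piD -quotmod_scale_pi. Qed.

Lemma quotmod_pi0 (V : lmodType R) (S : submodClosed V) (v : V) :
  quotmod_pi S v = 0 <-> v \in S.
Proof.
have -> : 0 = quotmod_pi S 0.
  by rewrite -[X in quotmod_pi _ X](scale0r 0) -quotmod_scale_pi
    [quotmod_scale _ _](scale0r (quotmod_pi S 0)).
by split=> [/eqP|vS]; [|apply/eqP]; rewrite quotmod_pi_eq subr0.
Qed.

Lemma quot_exists (V : lmodType R) (P : V -> Prop) : submodule P ->
  exists (C : lmodType R) (p : {linear V -> C}),
    surj_linear p /\ forall v, p v = 0 <-> P v.
Proof.
move=> /submodule_bundle[S hS].
pose mix := GRing.isLinear.Build R V (quotmod S) *:%R (@quotmod_pi R V S)
  (@quotmod_pi_linear V S).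
pose p : {linear V -> quotmod S} := HB.pack (@quotmod_pi R V S) mix.
exists (quotmod S), p; split.
  by move=> y; exists (quotmod_repr y); apply: quotmod_reprK.
by move=> v; rewrite -hS; exact: quotmod_pi0.
Qed.

(** Maps obtained by diagram chasing, connecting homomorphisms among them, are
    first described as relations; choice turns them into linear maps. *)
Lemma linear_of_rel (U V : lmodType R) (r : U -> V -> Prop) :
  (forall u, exists v, r u v) -> (forall v, r 0 v -> v = 0) ->
  (forall a u u' v v', r u v -> r u' v' -> r (a *: u + u') (a *: v + v')) ->
  exists f : {linear U -> V}, forall u, r u (f u).
Proof.
move=> tot sv lin; have [f0 hf] := choice tot.
have uniq u v : r u v -> v = f0 u.
  move=> ruv; have := lin (-1) _ _ _ _ (hf u) ruv.
  rewrite scaleN1r addNr => /sv /eqP; rewrite scaleN1r addrC subr_eq0.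
  by move/eqP.
have fl : linear f0 by move=> a x y; apply/esym/uniq/lin.
pose mix := GRing.isLinear.Build R U V *:%R f0 fl.
by exists (HB.pack f0 mix : {linear U -> V}).
Qed.

Lemma factor_surj (B C X : lmodType R) (p : {linear B -> C})
  (f : {linear B -> X}) : surj_linear p -> (forall b, p b = 0 -> f b = 0) ->
  exists g : {linear C -> X}, forall b, g (p b) = f b.
Proof.
move=> ps pf; pose r c x := exists2 b, p b = c & f b = x.
have [||| g hg] := @linear_of_rel C X r.
- by move=> c; have [b pb] := ps c; exists (f b), b.
- by move=> v [b pb <-]; exact: pf.
- move=> a _ _ _ _ [b <- <-] [b' <- <-].
  by exists (a *: b + b'); rewrite linearP.
exists g => b; have [b' pb <-] := hg (p b); apply/esym/subr0_eq.
by rewrite -linearB; apply: pf; rewrite linearB /= pb subrr.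
Qed.

Lemma factor_inj (A B X : lmodType R) (i : {linear A -> B})
  (f : {linear X -> B}) : inj_linear i -> (forall x, exists a, i a = f x) ->
  exists g : {linear X -> A}, forall x, i (g x) = f x.
Proof.
move=> ii fi; pose r x a := i a = f x.
have [||| g hg] := @linear_of_rel X A r.
- by [].
- by move=> a; rewrite /r raddf0 => /ii.
- by move=> a u u' v v' h h'; rewrite /r !linearP /= h h'.
by exists g.
Qed.

(** Peeling generators off one at a time makes the inductions on generating
    sequences direct; [spanP] recovers the usual linear combinations. *)
Fixpoint span (V : lmodType R) (s : seq V) : V -> Prop :=
  if s is z :: s' then fun v => exists r, span s' (v - r *: z)
  else fun v => v = 0.

Lemma span_submodule (V : lmodType R) (s : seq V) : submodule (span s).
Proof.
elim: s => [|z s IH] /=; first by split=> [//|a x y -> ->]; rewrite scaler0 addr0.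
split; first by exists 0; rewrite scale0r subr0; exact: IH.1.
move=> a x y [r hr] [t ht]; exists (a * r + t).
have -> : a *: x + y - (a * r + t) *: z = a *: (x - r *: z) + (y - t *: z).
  by rewrite scalerDl scalerBr scalerA addrACA opprD.
exact: IH.2.
Qed.

Lemma span_sub (V : lmodType R) (s : seq V) P : submodule P ->
  (forall i, (i < size s)%N -> P s`_i) -> forall v, span s v -> P v.
Proof.
move=> hP; elim: s => [|z s IH] hs v /=; first by move=> ->; exact: hP.1.
move=> [r hr]; have -> : v = r *: z + (v - r *: z) by rewrite addrC subrK.
by apply: hP.2; [apply: (hs 0%N)|apply: IH => // i hi; apply: (hs i.+1)].
Qed.

Lemma span_mem (V : lmodType R) (s : seq V) i : (i < size s)%N -> span s s`_i.
Proof.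
elim: s i => [|z s IH] [|i] //= hi.
  by exists 1; rewrite scale1r subrr; exact: (span_submodule s).1.
by exists 0; rewrite scale0r subr0; apply: IH.
Qed.

Lemma span_map (U V : lmodType R) (f : {linear U -> V}) s u :
  span s u -> span (map f s) (f u).
Proof.
elim: s u => [|z s IH] u /=; first by move=> ->; rewrite raddf0.
by move=> [r /IH]; rewrite linearB linearZ /=; exists r.
Qed.

Lemma spanP (V : lmodType R) (s : seq V) v :
  span s v <-> exists c : 'I_(size s) -> R, v = \sum_(i < size s) c i *: s`_i.
Proof.
split; last first.
  move=> [c ->]; elim/big_ind: _ => [|x y|i _]; first exact: (span_submodule s).1.
    exact: submoduleD (span_submodule s) _ _.
  by apply: submoduleZ (span_submodule s) _ _ _; apply: span_mem.
elim: s v => [|z s IH] v /=.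
  by move=> ->; exists (fun _ => 0); rewrite big_ord0.
move=> [r /IH[c hc]]; exists (fun i => if unlift ord0 i is Some j then c j else r).
rewrite big_ord_recl unlift_none /=.
under eq_bigr => i _ do rewrite liftK.
by rewrite -hc addrC subrK.
Qed.

Definition fin_spanned (V : lmodType R) := exists s : seq V, forall v, span s v.

Lemma fin_genP (V : lmodType R) : fin_gen V <-> fin_spanned V.
Proof.
split=> -[s hs]; exists s.
  by move=> v; apply/spanP/(proj1 (hs v)).
by move=> v; split=> // _; exact/spanP.
Qed.

Definition noeth_module (V : lmodType R) := forall P : V -> Prop, submodule P ->
  exists s : seq V, forall v, P v <-> span s v.

Lemma noeth_fin_spanned V : noeth_module V -> fin_spanned V.
Proof.
move=> /(_ (fun=> True)) []; first by split.
by move=> s hs; exists s => v; apply/(hs v).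
Qed.

Lemma span_lift (U V : lmodType R) (f : {linear U -> V}) (Q : U -> Prop) s :
  submodule Q -> (forall v, span s v -> exists2 u, Q u & f u = v) ->
  exists2 t, (forall u, span t u -> Q u) &
    forall v, span s v -> exists2 u, span t u & f u = v.
Proof.
move=> hQ; elim: s => [|z s IH] hs.
  exists [::] => [u ->|v ->]; first exact: hQ.1.
  by exists 0; rewrite ?raddf0.
have [|t tQ ht] := IH.
  by move=> v hv; apply: hs; exists 0; rewrite scale0r subr0.
have [w Qw fw] : exists2 u, Q u & f u = z.
  by apply: hs; exact: (@span_mem _ (z :: s) 0%N).
exists (w :: t) => [u [r /tQ hu]|v [r /ht[u tu fu]]].
  by rewrite -[u](subrK (r *: w)) addrC; exact: hQ.2.
exists (r *: w + u); first by exists r; rewrite addrAC subrr add0r.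
by rewrite linearP /= fw fu addrC subrK.
Qed.

Lemma span_cat (V : lmodType R) (s t : seq V) u v :
  span s u -> span t v -> span (s ++ t) (u + v).
Proof.
elim: s u => [|z s IH] u /=; first by move=> ->; rewrite add0r.
by move=> [r hr] hv; exists r; rewrite addrAC; exact: IH.
Qed.

Lemma span_catP (V : lmodType R) (s t : seq V) w : span (s ++ t) w ->
  exists2 u, span s u & span t (w - u).
Proof.
elim: s w => [|z s IH] w /=; first by exists 0; rewrite ?subr0.
move=> [r /IH[u su tu]]; exists (r *: z + u); last by rewrite opprD addrA.
by exists r; rewrite addrAC subrr add0r.
Qed.

(** Generators of the image of P in W, lifted to P, together with generators of
    the part of P coming from U. Only exactness in the middle is required, as
    this is all that a long exact sequence offers. *)
Lemma noeth_exact (U V W : lmodType R) (f : {linear U -> V})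
  (g : {linear V -> W}) : exact_at f g -> noeth_module U -> noeth_module W -> noeth_module V.
Proof.
move=> ex nU nW P hP.
have [s hs] : exists s, forall w, (exists2 v, P v & g v = w) <-> span s w.
  apply: nW; split; first by exists 0; [exact: hP.1|exact: raddf0].
  move=> a _ _ [x px <-] [y py <-]; exists (a *: x + y); first exact: hP.2.
  by rewrite linearP.
have [t ht] : exists t, forall u, P (f u) <-> span t u.
  apply: nU; split; first by rewrite raddf0; exact: hP.1.
  by move=> a x y px py; rewrite linearP; exact: hP.2.
have [q qP hq] := span_lift hP (fun w => proj2 (hs w)).
exists (map f t ++ q) => v; split=> [pv|].
  have [u qu gu] : exists2 u, span q u & g u = g v.
    by apply/hq/hs; exists v.
  have /ex[x fx] : g (v - u) = 0 by rewrite raddfB /= gu subrr.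
  rewrite -[v](subrK u); apply: span_cat => //; rewrite -fx; apply: span_map.
  by apply/ht; rewrite fx; apply: submoduleB => //; exact: qP.
move=> /span_catP[u su qu]; rewrite -[v](subrK u); apply: submoduleD => //; first exact: qP.
move: su; apply: span_sub => // i; rewrite size_map => hi.
by rewrite (nth_map 0) //; apply/ht/span_mem.
Qed.

Definition scale_map (V : lmodType R) (a : R) : {linear V -> V} := a \*: idfun.

Lemma noeth_surj (V W : lmodType R) (g : {linear V -> W}) :
  surj_linear g -> noeth_module V -> noeth_module W.
Proof.
move=> gs nV P hP; have [|s hs] := nV (fun v => P (g v)).
  by split=> [|a x y px py]; rewrite ?raddf0 ?linearP; [exact: hP.1|exact: hP.2].
exists (map g s) => w; split=> [pw|].
  have [v gv] := gs w; rewrite -gv; apply/span_map/hs; by rewrite gv.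
apply: span_sub => // i; rewrite size_map => hi.
by rewrite (nth_map 0) //; apply/hs/span_mem.
Qed.

Lemma noeth_inj (U V : lmodType R) (f : {linear U -> V}) :
  inj_linear f -> noeth_module V -> noeth_module U.
Proof.
move=> fi nV P hP; have [|s hs] := nV (fun v => exists2 u, P u & f u = v).
  split; first by exists 0; [exact: hP.1|exact: raddf0].
  move=> a _ _ [x px <-] [y py <-]; exists (a *: x + y); first exact: hP.2.
  by rewrite linearP.
have [t tP ht] := span_lift hP (fun v => proj2 (hs v)).
exists t => u; split=> [pu|]; last exact: tP.
have [|u' tu' /(inj_linearP fi) <- //] := ht (f u).
by apply/hs; exists u.
Qed.

Lemma noeth_acc (V : lmodType R) (P : nat -> V -> Prop) : noeth_module V ->
  (forall n, submodule (P n)) -> (forall n v, P n v -> P n.+1 v) ->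
  exists k, forall n v, P n v -> P k v.
Proof.
move=> nV hP inc.
have mono i j v : (i <= j)%N -> P i v -> P j v.
  by move=> /subnK <-; elim: (j - i)%N => [//|l IH] /IH; apply: inc.
have [|s hs] := nV (fun v => exists n, P n v).
  split; first by exists 0%N; exact: (hP 0%N).1.
  move=> a x y [i px] [j py]; exists (maxn i j); apply: (hP _).2.
    by apply: mono px; exact: leq_maxl.
  by apply: mono py; exact: leq_maxr.
have [k hk] : exists k, forall v, span s v -> P k v.
  have {hs} : forall v, span s v -> exists n, P n v by move=> v /hs.
  elim: s => [|z s IH] hs; first by exists 0%N => v ->; exact: (hP 0%N).1.
  have [|k hk] := IH.
    by move=> v hv; apply: hs; exists 0; rewrite scale0r subr0.
  have [l hl] : exists n, P n z by apply: hs; exact: (@span_mem _ (z :: s) 0%N).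
  exists (maxn k l) => v [r /hk hv]; rewrite -[v](subrK (r *: z)) addrC.
  apply: (hP _).2; first by apply: mono hl; exact: leq_maxr.
  by apply: mono hv; exact: leq_maxl.
by exists k => n v pv; apply/hk/hs; exists n.
Qed.

End Modules.

(** * Ideals and noetherian induction *)

Section Noeth.
Variable R : comNzRingType.

(** Without a maximal member, dependent choice would produce a strictly
    increasing sequence. *)
Lemma noeth_max (V : lmodType R) (F : (V -> Prop) -> Prop) P0 : noeth_module V ->
  F P0 -> (forall P, F P -> submodule P) ->
  exists2 P, F P & forall Q, F Q -> (forall v, P v -> Q v) -> forall v, Q v -> P v.
Proof.
move=> nV FP0 Fs; apply: contrapT => nomax.
have /choice[next hnext] : forall P, exists Q, F P ->
    [/\ F Q, forall v, P v -> Q v & ~ forall v, Q v -> P v].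
  move=> P; have [FP|nFP] := EM (F P); last by exists P.
  apply: contrapT => nQ; apply: nomax; exists P => // Q FQ PQ.
  by apply: contrapT => nQP; apply: nQ; exists Q.
pose c n := iter n next P0.
have Fc n : F (c n) by elim: n => [//|n IH]; case: (hnext _ IH).
have [|k hk] := noeth_acc nV (fun n => Fs _ (Fc n)).
  by move=> n v; have [_ h _] := hnext _ (Fc n); apply: h.
by have [_ _] := hnext _ (Fc k); apply; exact: (hk k.+1).
Qed.

Definition is_ideal (I : R -> Prop) := @submodule R R^o I.

Lemma idealM I a x : is_ideal I -> I x -> I (a * x).
Proof. by move=> hI; exact: (@submoduleZ R R^o). Qed.
Lemma idealMr I a x : is_ideal I -> I x -> I (x * a).
Proof. by move=> hI Ix; rewrite mulrC; exact: idealM. Qed.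
Lemma idealD I x y : is_ideal I -> I x -> I y -> I (x + y).
Proof. by move=> hI; exact: (@submoduleD R R^o). Qed.
Lemma idealB I x y : is_ideal I -> I x -> I y -> I (x - y).
Proof. by move=> hI; exact: (@submoduleB R R^o). Qed.

Definition is_prime (p : R -> Prop) :=
  [/\ is_ideal p, ~ p 1 & forall a b, p (a * b) -> p a \/ p b].

Lemma primeX p a k : is_prime p -> p (a ^+ k) -> p a.
Proof.
case=> hp p1 pM; elim: k => [|k IH]; first by rewrite expr0 => /p1.
by rewrite exprS => /pM[].
Qed.

Lemma primeNM p a b : is_prime p -> ~ p a -> ~ p b -> ~ p (a * b).
Proof. by case=> _ _ pM na nb /pM[]. Qed.

Definition colon (I : R -> Prop) (a : R) : R -> Prop := fun r => I (r * a).
Definition adjoin (I : R -> Prop) (a : R) : R -> Prop :=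
  fun r => exists c, I (r - c * a).

Lemma colon_ideal I a : is_ideal I -> is_ideal (colon I a).
Proof.
move=> hI; split; first by rewrite /colon mul0r; exact: hI.1.
by move=> b x y hx hy; rewrite /colon mulrDl -mulrA; exact: hI.2.
Qed.

Lemma adjoin_ideal I a : is_ideal I -> is_ideal (adjoin I a).
Proof.
move=> hI; split; first by exists 0; rewrite mul0r subr0; exact: hI.1.
move=> b x y [c hc] [e he]; exists (b * c + e).
have -> : b *: (x : R^o) + y - (b * c + e) * a = b * (x - c * a) + (y - e * a).
  by rewrite mulrBr mulrDl mulrA opprD addrACA.
exact: hI.2.
Qed.

Lemma sub_colon I a x : is_ideal I -> I x -> colon I a x.
Proof. by move=> hI Ix; exact: idealMr. Qed.
Lemma sub_adjoin (I : R -> Prop) a x : I x -> adjoin I a x.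
Proof. by move=> Ix; exists 0; rewrite mul0r subr0. Qed.
Lemma adjoin_self I a : is_ideal I -> adjoin I a a.
Proof. by move=> hI; exists 1; rewrite mul1r subrr; exact: hI.1. Qed.
Lemma adjoin_min (I p : R -> Prop) a x : is_ideal p -> (forall x, I x ->
  p x) -> p a ->
  adjoin I a x -> p x.
Proof.
by move=> hp Ip pa [c /Ip h]; rewrite -[x](subrK (c * a)); apply: idealD => //; exact: idealM.
Qed.

Hypothesis nR : noeth_module R^o.

(** If I is proper and not prime, choose ab in I with a and b outside I. Both
    I : a, which contains b, and I + (a) are strictly larger than I, so a maximal
    counterexample is prime. This one induction replaces prime filtrations,
    minimal primes and primary decomposition. *)
Lemma ideal_ind (Psi : (R -> Prop) -> Prop) :
  (forall p, is_prime p -> Psi p) -> (forall I, is_ideal I -> I 1 -> Psi I) ->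
  (forall I a, is_ideal I -> Psi (colon I a) -> Psi (adjoin I a) -> Psi I) ->
  forall I, is_ideal I -> Psi I.
Proof.
move=> Pp P1 Ps I hI; apply: contrapT => nPI.
have [|J [hJ nPJ] Jmax] := @noeth_max R^o (fun J => is_ideal J /\ ~ Psi J) I nR (conj hI nPI).
  by move=> P [].
have big K : is_ideal K -> (forall x, J x -> K x) -> (exists2 x, K x & ~ J x) -> Psi K.
  move=> hK JK [x Kx nJx]; apply: contrapT => nPK.
  by apply: nJx; apply: (Jmax K).
apply: nPJ; have [J1|nJ1] := EM (J 1); first exact: P1.
have [pJ|] := EM (forall a b, J (a * b) -> J a \/ J b); first by apply: Pp.
move=> /existsNP[a /existsNP[b /not_implyP[Jab /not_orP[nJa nJb]]]].
apply: (Ps J a hJ).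
  apply: big; [exact: colon_ideal|by move=> x; exact: sub_colon|].
  by exists b => //; rewrite /colon mulrC.
apply: big; [exact: adjoin_ideal|by move=> x; exact: sub_adjoin|].
by exists a => //; exact: adjoin_self.
Qed.

End Noeth.

(** * Cyclic modules and devissage *)

Section Cyclic.
Variable R : comNzRingType.

Definition annihilator (V : lmodType R) (z : V) : R ->
  Prop := fun r => r *: z = 0.

Lemma annihilator_ideal (V : lmodType R) (z : V) : is_ideal (annihilator z).
Proof.
split; first exact: scale0r.
by move=> a x y hx hy; rewrite /annihilator scalerDl -scalerA hx hy scaler0 addr0.
Qed.

Lemma orbit_map (V : lmodType R) (z : V) :
  exists f : {linear R^o -> V}, forall r, f r = r *: z.
Proof.
pose f0 (r : R^o) : V := r *: z.
have fl : linear f0 by move=> a x y; rewrite /f0 scalerDl scalerA.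
pose mix := GRing.isLinear.Build R R^o V *:%R f0 fl.
by exists (HB.pack f0 mix : {linear R^o -> V}).
Qed.

(** C is isomorphic to R / I with z corresponding to 1, so a presentation of a
    submodule such as Rz needs no transport along an isomorphism. *)
Definition cyc (I : R -> Prop) (C : lmodType R) (z : C) :=
  (forall c, exists r, c = r *: z) /\ forall r, r *: z = 0 <-> I r.

Lemma cyc_exists I : is_ideal I -> exists (C : lmodType R) (z : C), cyc I z.
Proof.
move=> /quot_exists[C [p [ps hp]]]; exists C, (p 1); split.
  move=> c; have [r <-] := ps c; exists r.
  by rewrite -linearZ /= [_ *: _]mulr1.
by move=> r; rewrite -hp -linearZ /= [_ *: _]mulr1.
Qed.

Lemma cyc_ideal I (C : lmodType R) (z : C) : cyc I z -> is_ideal I.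
Proof.
move=> [_ hz]; split; first by apply/hz; exact: scale0r.
move=> a x y /hz hx /hz hy; apply/hz.
by rewrite scalerDl -scalerA hx hy scaler0 addr0.
Qed.

Lemma cyc_map I (C M : lmodType R) (z : C) (w : M) : cyc I z ->
  (forall r, I r -> r *: w = 0) -> exists f : {linear C -> M}, f z = w.
Proof.
move=> [gen hz] hw; have [f hf] := orbit_map z; have [g hg] := orbit_map w.
have [||h hh] := @factor_surj R _ _ _ f g.
- by move=> c; have [r ->] := gen c; exists r.
- by move=> r; rewrite hf hg => /hz /hw.
by exists h; rewrite -[z]scale1r -hf hh hg scale1r.
Qed.

Lemma cyc_sub (V : lmodType R) (z : V) : exists (A : lmodType R)
  (i : {linear A -> V}) (w : A), [/\ inj_linear i, i w = z & cyc (annihilator z) w].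
Proof.
have [|A [i [ii hi]]] := @sub_exists R V (fun v => exists r, v = r *: z).
  split; first by exists 0; rewrite scale0r.
  by move=> a _ _ [r ->] [t ->]; exists (a * r + t); rewrite scalerDl scalerA.
have [w hw] : exists w, i w = z by apply/hi; exists 1; rewrite scale1r.
exists A, i, w; split=> //; split.
  move=> c; have /hi[r hr] : exists a, i a = i c by exists c.
  by exists r; apply: (inj_linearP ii); rewrite linearZ /= hw.
move=> r; rewrite /annihilator -hw -linearZ; split=> [->|/ii //]; exact: raddf0.
Qed.

Lemma cyc_ext (I J : R -> Prop) (C : lmodType R) (z : C) :
  (forall r, I r <-> J r) -> cyc I z -> cyc J z.
Proof. by move=> IJ [gen hz]; split=> // r; rewrite hz IJ. Qed.

Lemma cyc_noeth I (C : lmodType R) (z : C) : noeth_module R^o -> cyc I z ->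
  noeth_module C.
Proof.
move=> nR [gen _]; have [f hf] := orbit_map z.
by apply: noeth_surj nR => c; have [r ->] := gen c; exists r.
Qed.

(** The submodule generated by az is R / (I : a) and the quotient by it is
    R / (I + (a)): the module counterpart of the step of [ideal_ind]. *)
Lemma cyc_split I (C : lmodType R) (z : C) a : cyc I z ->
  exists (A D : lmodType R) (i : {linear A -> C}) (p : {linear C -> D})
    (w : A) (w' : D), [/\ short_exact i p, i w = a *: z, p z = w',
       cyc (colon I a) w & cyc (adjoin I a) w'].
Proof.
move=> hC; have [gen hz] := hC; have [A [i [w [ii iw hA]]]] := cyc_sub (a *: z).
have [|D [p [ps hp]]] := @quot_exists R C (fun c => exists x, i x = c).
  split; first by exists 0; exact: raddf0.
  by move=> b _ _ [x <-] [y <-]; exists (b *: x + y); rewrite linearP.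
exists A, D, i, p, w, (p z); split=> //.
  by apply: cyc_ext hA => r; rewrite /annihilator scalerA hz.
split.
  move=> d; have [c <-] := ps d; have [r ->] := gen c.
  by exists r; rewrite linearZ.
move=> r; rewrite -linearZ hp; split=> [[x ix]|[c /hz]].
  have [t ht] := hA.1 x; exists t; apply/hz; apply/eqP.
  by rewrite scalerBl -ix ht linearZ /= iw scalerA subrr.
rewrite scalerBl => /subr0_eq ->; exists (c *: w).
by rewrite linearZ /= iw scalerA.
Qed.

Lemma fin_spanned_surj (V W : lmodType R) (g : {linear V -> W}) :
  surj_linear g -> fin_spanned V -> fin_spanned W.
Proof.
move=> gs [s hs]; exists (map g s) => w; have [v <-] := gs w.
exact: span_map.
Qed.

Definition killed (I : R -> Prop) (V : lmodType R) :=
  forall r (v : V), I r -> r *: v = 0.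

Lemma killed_surj I (U V : lmodType R) (f : {linear U -> V}) :
  surj_linear f -> killed I U -> killed I V.
Proof. by move=> fs kU r v Ir; have [u <-] := fs v; rewrite -linearZ /= kU ?raddf0. Qed.

Definition ext_closed (Phi : lmodType R -> Prop) :=
  forall (A B C : lmodType R) (i : {linear A -> B}) (p : {linear B -> C}),
    short_exact i p -> Phi A -> Phi C -> Phi B.

(** Splits off the submodule generated by the first generator. *)
Lemma fin_spanned_ind (Phi : lmodType R -> Prop) (I0 : R -> Prop) :
  ext_closed Phi ->
  (forall I, is_ideal I -> (forall r, I0 r -> I r) ->
     forall (C : lmodType R) (z : C), cyc I z -> Phi C) ->
  forall M, fin_spanned M -> killed I0 M -> Phi M.
Proof.
move=> ext Pc M [s]; move: {2}(size s) (erefl (size s)) => n.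
elim: n M s => [|n IH] M [|z s] //= sn hs kM.
  apply: (Pc (fun=> True) _ _ M 0) => //; split=> [c|r].
    by exists 0; rewrite scaler0; exact: hs.
  by split=> // _; rewrite scaler0.
have [A [i [w [ii iw hA]]]] := cyc_sub z.
have [|D [p [ps hp]]] := @quot_exists R M (fun c => exists x, i x = c).
  split; first by exists 0; exact: raddf0.
  by move=> b _ _ [x <-] [y <-]; exists (b *: x + y); rewrite linearP.
have pz : p z = 0 by apply/hp; exists w.
apply: (ext _ _ _ i p) => //.
  apply: Pc hA; first exact: annihilator_ideal.
  by move=> r; exact: kM.
apply: (IH D (map p s)); [by rewrite size_map; case: sn| |exact: killed_surj kM].
move=> d; have [v <-] := ps d; have [r /(@span_map _ _ _ p)] := hs v.
by rewrite raddfB /= linearZ /= pz scaler0 subr0.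
Qed.

(** The ideal I0 records a common annihilator, which restricts the primes that
    have to be considered to those containing it. *)
Lemma devissage (Phi : lmodType R -> Prop) (I0 : R -> Prop) :
  noeth_module R^o -> ext_closed Phi ->
  (forall V : lmodType R, (forall v : V, v = 0) -> Phi V) ->
  (forall p, is_prime p -> (forall r, I0 r -> p r) ->
     forall (C : lmodType R) (z : C), cyc p z -> Phi C) ->
  forall M, fin_spanned M -> killed I0 M -> Phi M.
Proof.
move=> nR ext P0 Pp; apply: (fin_spanned_ind ext); apply: (ideal_ind nR).
- by move=> p pp; exact: Pp.
- move=> I hI I1 _ C z [gen hz]; apply: P0 => c; have [r ->] := gen c.
  by apply/hz; rewrite -[r]mulr1; exact: idealM.
move=> I a hI IHc IHa I0I C z /(cyc_split a)[A [D [i [p [w [w' [hs _ _ hA hD]]]]]]].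
apply: (ext _ _ _ _ _ hs); [apply: (IHc _ _ _ hA)|apply: (IHa _ _ _ hD)] => r /I0I.
  exact: sub_colon.
exact: sub_adjoin.
Qed.

Lemma fin_spanned_noeth (M : lmodType R) : noeth_module R^o -> fin_spanned M ->
  noeth_module M.
Proof.
move=> nR hM; apply: (@fin_spanned_ind (@noeth_module R) (fun=> False)) hM _ => //; last first.
  by move=> I hI _ C z; exact: cyc_noeth.
by move=> A B C i p [_ _ ex]; exact: (noeth_exact ex).
Qed.

End Cyclic.

(** * Cohomology classes and their representatives *)

Section Representatives.
Variables (R : comNzRingType) (C : cochain_complex R) (n : nat).

(** Working with pairs of a cocycle and its class avoids both the subtype of
    cocycles and the quotient by coboundaries. *)
Definition represents (f : C n) (u : cohomology C n) :=
  exists2 z : cocycles C n, cocycle_val z = f & quotmod_pi (@coboundary R C n) z = u.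

Lemma rep_ex u : exists f, represents f u.
Proof. by exists (cocycle_val (quotmod_repr u)), (quotmod_repr u) => //; exact: quotmod_reprK. Qed.

Lemma rep_cocycle f u : represents f u -> cc_diff C n f = 0.
Proof. by case=> z <- _; apply/eqP; exact: (valP z). Qed.

Lemma cocycle_rep f : cc_diff C n f = 0 -> exists u, represents f u.
Proof.
move=> df; have fc : f \in submod_pred (cocycle C n) by rewrite [_ \in _]inE; apply/eqP.
by exists (quotmod_pi _ (exist _ f fc : cocycles C n)), (exist _ f fc).
Qed.

Lemma rep_linear a f g u v : represents f u -> represents g v ->
  represents (a *: f + g) (a *: u + v).
Proof.
case=> x <- <- [y <- <-]; exists (a *: x + y) => //.
exact: quotmod_pi_linear.
Qed.

Lemma rep0 f u : represents f u -> u = 0 <-> is_coboundary f.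
Proof.
by case=> z <- <-; rewrite quotmod_pi0; split=> /coboundaryP.
Qed.

Lemma rep_uniq f u v : represents f u -> represents f v -> u = v.
Proof.
move=> hu hv; have h := rep_linear (-1) hu hv; apply/esym/subr0_eq.
rewrite addrC -scaleN1r; apply/(rep0 h); rewrite scaleN1r addNr.
by case: (n) => [//|k] /=; exists 0; rewrite raddf0.
Qed.

End Representatives.

Lemma cohomology_map (R : comNzRingType) (C D : cochain_complex R) (n : nat)
  (phi : {linear C n -> D n}) :
  (forall f, cc_diff C n f = 0 -> cc_diff D n (phi f) = 0) ->
  (forall f, is_coboundary f -> is_coboundary (phi f)) ->
  exists h : {linear cohomology C n -> cohomology D n},
    forall f u, represents f u -> represents (phi f) (h u).
Proof.
move=> hc hb.
pose r u v := exists2 f, represents f u & represents (phi f) v.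
have [||a u u' v v' [f fu fv] [g gu gv]|h hh] := @linear_of_rel R _ _ r.
- move=> u; have [f fu] := rep_ex u.
  by have [v hv] := cocycle_rep (hc _ (rep_cocycle fu)); exists v, f.
- by move=> v [f /rep0 f0 /rep0 ->]; apply: hb; apply/f0.
- exists (a *: f + g); first exact: rep_linear.
  by rewrite linearP; exact: rep_linear.
exists h => f u fu; have [g gu gv] := hh u.
have [v hv] := cocycle_rep (hc _ (rep_cocycle fu)).
suff <- : v = h u by [].
have h1 := rep_linear (-1) fu gu; have h2 := rep_linear (-1) hv gv.
apply/esym/subr0_eq; rewrite addrC -scaleN1r; apply/(rep0 h2).
rewrite -linearP; apply: hb; apply/(rep0 h1); by rewrite scaleN1r addNr.
Qed.

(** * Ext from an injective resolution of the second argument *)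

Section ExtInj.
Variables (R : comNzRingType) (N : lmodType R) (E : injective_resolution N).

Definition Hom_postcomp (M : lmodType R) n (g : Hom M (E n)) : Hom M (E n.+1) :=
  (ir_diff E n \o g : {linear M -> E n.+1}).

Lemma Hom_postcomp_is_linear M n : linear (@Hom_postcomp M n).
Proof. by move=> a g h; apply: Hom_ext => x /=; rewrite linearP. Qed.

HB.instance Definition _ M n := GRing.isLinear.Build R (Hom M (E n)) (Hom M (E n.+1))
  *:%R (@Hom_postcomp M n) (@Hom_postcomp_is_linear M n).

Lemma ir_diffK n x : ir_diff E n.+1 (ir_diff E n x) = 0.
Proof. by apply/ir_exactS; exists x. Qed.

Lemma homE_diffK M n (f : Hom M (E n)) : Hom_postcomp (Hom_postcomp f) = 0.
Proof. by apply: Hom_ext => x /=; exact: ir_diffK. Qed.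

Definition homE (M : lmodType R) : cochain_complex R :=
  @CochainComplex R (fun n => Hom M (E n)) (fun n => @Hom_postcomp M n)
    (@homE_diffK M).

Definition ExtE i M := cohomology (homE M) i.

Lemma homE_cocycle M n (f : homE M n) :
  cc_diff (homE M) n f = 0 <-> forall x, ir_diff E n (f x) = 0.
Proof.
split=> [/(congr1 (fun g : Hom _ _ => (g : M -> _)))h x|h]; last exact: Hom_ext.
exact: (congr1 (fun g => g x) h).
Qed.

(** [is_coboundary] unfolded to an equality of values, the form in which the
    diagram chases use it. *)
Definition homE_coboundary M n : Hom M (E n) -> Prop :=
  match n return Hom M (E n) -> Prop with
  | 0 => fun f => forall x, f x = 0
  | k.+1 => fun f => exists g : {linear M -> E k}, forall x, f x = ir_diff E k (g x)
  end.

Lemma homE_coboundaryP M n (f : homE M n) : is_coboundary f <-> homE_coboundary f.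
Proof.
case: n f => [|n] f /=; first by split=> [->|h] //; exact: Hom_ext.
by split=> -[g hg]; exists g; [move=> x; rewrite hg|exact: Hom_ext].
Qed.

Lemma ExtE_map_exists i (A B : lmodType R) (phi : {linear A -> B}) :
  exists h : {linear ExtE i B -> ExtE i A},
    forall (f : homE B i) u, represents f u -> @represents _ (homE A) i (Hom_precomp (E i) phi f) (h u).
Proof.
apply: (@cohomology_map R (homE B) (homE A) i (Hom_precomp (E i) phi)).
  by move=> f /homE_cocycle df; apply/homE_cocycle => x /=; apply: df.
move=> f /homE_coboundaryP h; apply/homE_coboundaryP; case: i f h => [|i] f /= h; first by move=> x.
by case: h => g hg; exists (g \o phi : {linear A -> E i}).
Qed.

Definition ExtE_map i (A B : lmodType R) (phi : {linear A -> B}) :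
  {linear ExtE i B -> ExtE i A} := projT1 (cid (ExtE_map_exists i phi)).

Lemma ExtE_mapP i (A B : lmodType R) (phi : {linear A -> B}) (f : homE B i) u :
  represents f u -> @represents _ (homE A) i (Hom_precomp (E i) phi f) (ExtE_map i phi u).
Proof. by rewrite /ExtE_map; case: cid => h /= hh; exact: hh. Qed.

Lemma ExtE_map_comp i (A B C : lmodType R) (f : {linear A -> B}) (g :
  {linear B -> C})
  (h : {linear A -> C}) : (forall x, h x = g (f x)) ->
  forall u, ExtE_map i h u = ExtE_map i f (ExtE_map i g u).
Proof.
move=> hfg u; have [r ru] := rep_ex u.
apply: rep_uniq (ExtE_mapP _ ru) _.
have -> : Hom_precomp (E i) h r = Hom_precomp (E i) f (Hom_precomp (E i) g r).
  by apply: Hom_ext => x /=; rewrite hfg.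
by do 2 apply: ExtE_mapP.
Qed.

(** Multiplication by a on M induces multiplication by a on Ext, which lets
    annihilators of Ext be read off from factorizations of endomorphisms of M. *)
Lemma ExtE_map_scale i (M : lmodType R) (f : {linear M -> M}) a :
  (forall x, f x = a *: x) -> forall u, ExtE_map i f u = a *: u.
Proof.
move=> fa u; have [r ru] := rep_ex u; apply: rep_uniq (ExtE_mapP _ ru) _.
have -> : Hom_precomp (E i) f r = a *: r.
  by apply: Hom_ext => x /=; rewrite fa linearZ.
have [z z0] := @cocycle_rep _ (homE M) i 0 (raddf0 _).
have -> : a *: u = a *: u + z.
  rewrite (_ : z = 0) ?addr0 //; apply/(rep0 z0)/homE_coboundaryP.
  by case: (i) => [|k] //=; exists (\0 : {linear M -> E k}) => x; rewrite raddf0.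
by rewrite -[X in represents X]addr0; exact: rep_linear.
Qed.

Section LES.
Variables (A B C : lmodType R) (i : {linear A -> B}) (p : {linear B -> C}).
Hypothesis sip : short_exact i p.

Let pi0 x : p (i x) = 0.
Proof. by case: sip => _ _ ex; apply/ex; exists x. Qed.

Let extend n (f : {linear A -> E n}) :
  exists h : {linear B -> E n}, forall x, h (i x) = f x.
Proof. by case: sip => ii _ _; apply: ir_inj; exact: inj_linearP. Qed.

Let descend (X : lmodType R) (f : {linear B -> X}) : (forall x, f (i x) = 0) ->
  exists g : {linear C -> X}, forall x, g (p x) = f x.
Proof.
case: sip => _ ps ex fi; apply: factor_surj ps _ => b /ex[a <-]; exact: fi.
Qed.

(** A cocycle on B that bounds on A can be corrected, by extending the bounding
    map to B, so as to vanish on A; it then descends to C. *)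
Lemma ExtE_exact_middle n : exact_at (ExtE_map n p) (ExtE_map n i).
Proof.
have [ii ps ex] := sip; move=> u; split; last first.
  move=> [v <-]; have [f fv] := rep_ex v; have := ExtE_mapP i (ExtE_mapP p fv).
  move=> /rep0 ->; apply/homE_coboundaryP; case: (n) f {fv} => [|k] f /= ; last first.
    by exists (\0 : {linear A -> E k}) => x; rewrite pi0 !raddf0.
  by move=> x; rewrite pi0 raddf0.
have [f fu] := rep_ex u; move=> /(rep0 (ExtE_mapP i fu)) /homE_coboundaryP cf.
have [f' [f'u f'i]] : exists f' : homE B n, represents f' u /\ forall x, f' (i x) = 0.
  case: n f u fu cf => [|k] f u fu /= cf; first by exists f.
  have [g hg] := cf; have [h hh] := extend g.
  pose h' : Hom B (E k.+1) := (ir_diff E k \o h : {linear B -> E k.+1}).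
  exists (f - h'); split; last by move=> x /=; rewrite hh hg subrr.
  have [|z hz] := @cocycle_rep _ (homE B) k.+1 h'.
    by apply/homE_cocycle => x; exact: ir_diffK.
  have := rep_linear (-1) hz fu; rewrite !scaleN1r [- _ + _]addrC.
  rewrite (_ : z = 0) ?oppr0 ?add0r //; apply/(rep0 hz)/homE_coboundaryP; by exists h.
have [g hg] := descend f'i.
have [|v gv] := @cocycle_rep _ (homE C) n g.
  apply/homE_cocycle => c; have [b <-] := ps c; rewrite hg.
  by have /homE_cocycle := rep_cocycle f'u.
exists v; apply: rep_uniq (ExtE_mapP p gv) _.
suff -> : Hom_precomp (E n) p g = f' by [].
by apply: Hom_ext => x /=; rewrite hg.
Qed.

(** A cocycle f on A extends to a map h on B because E n is injective, and
    the differential of h vanishes on A, hence descends to C. *)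
Lemma ExtE_connecting n : exists d : {linear ExtE n A -> ExtE n.+1 C},
  exact_at (ExtE_map n i) d /\ exact_at d (ExtE_map n.+1 p).
Proof.
have [ii ps ex] := sip.
pose r (u : ExtE n A) (v : ExtE n.+1 C) := exists (f : {linear A -> E n}) (h : {linear B -> E n})
  (g : {linear C -> E n.+1}), [/\ @represents _ (homE A) n f u, @represents _ (homE C) n.+1 g v,
   forall x, h (i x) = f x & forall x, g (p x) = ir_diff E n (h x)].
have r0 u v : r u v -> v = 0 <-> exists w, ExtE_map n i w = u.
  move=> [f [h [g [fu gv hi gp]]]]; split.
    move=> /(rep0 gv)/homE_coboundaryP[k gk].
    pose h' : Hom B (E n) := (h \- (k \o p) : {linear B -> E n}).
    have [|w hw] := @cocycle_rep _ (homE B) n h'.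
      by apply/homE_cocycle => x /=; rewrite linearB /= -gk gp subrr.
    exists w; apply: rep_uniq (ExtE_mapP i hw) _.
    suff -> : Hom_precomp (E n) i h' = f by [].
    by apply: Hom_ext => x /=; rewrite pi0 raddf0 subr0 hi.
  move=> [w wu]; apply/(rep0 gv)/homE_coboundaryP.
  have [f' f'w] := rep_ex w.
  have := ExtE_mapP i f'w; rewrite wu => f'u.
  have [e [he de]] : exists e : {linear B -> E n},
      (forall x, e (i x) = f x) /\ forall x, ir_diff E n (e x) = 0.
    have /homE_cocycle df' := rep_cocycle f'w.
    have := rep_linear (-1) f'u fu; rewrite scaleN1r scaleN1r addNr.
    move=> h0; have /homE_coboundaryP := proj1 (rep0 h0) (erefl _).
    case: (n) f f' h g df' {h0 r fu gv hi gp f'u f'w u v w wu} => [|k] f f' h g df' /=.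
      move=> hf; exists f'; split=> // x; apply/esym/subr0_eq.
      by rewrite addrC; exact: hf.
    move=> [q hq]; have [q' hq'] := extend q.
    exists (f' \+ (ir_diff E k \o q') : {linear B -> E k.+1}); split=> x /=.
      by rewrite hq' -hq addrC addrAC addNr add0r.
    by rewrite linearD /= df' add0r ir_diffK.
  have [|k hk] := @descend _ (h \- e : {linear B -> E n}).
    by move=> x /=; rewrite hi he subrr.
  by exists k => c; have [b <-] := ps c; rewrite gp hk /= linearB /= de subr0.
have [||a u u' v v'|d hd] := @linear_of_rel R _ _ r.
- move=> u; have [f fu] := rep_ex u; have [h hh] := extend f.
  have [|g hg] := @descend _ (ir_diff E n \o h : {linear B -> E n.+1}).
    by move=> x /=; rewrite hh; have /homE_cocycle := rep_cocycle fu; apply.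
  have [|v gv] := @cocycle_rep _ (homE C) n.+1 g.
    by apply/homE_cocycle => c; have [b <-] := ps c; rewrite hg /= ir_diffK.
  by exists v, f, h, g.
- by move=> v rv; apply/(r0 _ _ rv); exists 0; rewrite raddf0.
- move=> [f [h [g [fu gv hi gp]]]] [f' [h' [g' [fu' gv' hi' gp']]]].
  exists ((a \*: f) \+ f'), ((a \*: h) \+ h'), ((a \*: g) \+ g'); split.
  + exact: (rep_linear a fu fu').
  + exact: (rep_linear a gv gv').
  + by move=> x /=; rewrite hi hi'.
  by move=> x /=; rewrite gp gp' linearP.
exists d; split; first by move=> u; apply: r0.
move=> v; split=> [|[u <-]].
  have [g gv] := rep_ex v; move=> /(rep0 (ExtE_mapP p gv))/homE_coboundaryP[h hh].
  pose f : Hom A (E n) := (h \o i : {linear A -> E n}).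
  have [|u fu] := @cocycle_rep _ (homE A) n f.
    by apply/homE_cocycle => x /=; rewrite -hh /= pi0 raddf0.
  exists u; have ruv : r u v by exists f, h, g.
  have [f2 [h2 [g2 [fu2 gv2 hi2 gp2]]]] := hd u.
  have r2 : r 0 (d u - v).
    exists ((- 1 \*: f) \+ f2), ((- 1 \*: h) \+ h2), ((- 1 \*: g) \+ g2); split.
    - by have := rep_linear (-1) fu fu2; rewrite [- 1 *: u]scaleN1r addNr.
    - by have := rep_linear (-1) gv gv2; rewrite [- 1 *: v]scaleN1r [- v + _]addrC.
    - by move=> x /=; rewrite hi2.
    by move=> x /=; rewrite gp2 linearP -hh.
  by apply/subr0_eq/(r0 _ _ r2); exists 0; rewrite raddf0.
have [f [h [g [_ gv _ gp]]]] := hd u.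
by apply/(rep0 (ExtE_mapP p gv))/homE_coboundaryP; exists h => x; rewrite -gp.
Qed.

Lemma ExtE0_map_inj : inj_linear (ExtE_map 0 p).
Proof.
move=> u; have [f fu] := rep_ex u; move=> /(rep0 (ExtE_mapP p fu))/homE_coboundaryP /= h.
apply/(rep0 fu)/homE_coboundaryP => c /=; have [_ ps _] := sip; have [b <-] := ps c; exact: h.
Qed.

End LES.

Lemma ExtE_projective (P : lmodType R) n (u : ExtE n.+1 P) : projective P ->
  u = 0.
Proof.
move=> hP; have [f fu] := rep_ex u; apply/(rep0 fu)/homE_coboundaryP.
have /homE_cocycle df := rep_cocycle fu.
have [|K [j [ji hj]]] := @sub_exists R (E n.+1) (fun y => ir_diff E n.+1 y = 0).
  by split=> [|a x y hx hy]; rewrite ?raddf0 ?linearP //= hx hy scaler0 addr0.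
have [g hg] : exists g : {linear P -> K}, forall x, j (g x) = f x.
  by apply: factor_inj ji _ => x; apply/hj.
have [q hq] : exists q : {linear E n -> K}, forall x, j (q x) = ir_diff E n x.
  by apply: factor_inj ji _ => x; apply/hj; exact: ir_diffK.
have [|h hh] := hP _ _ q g.
  move=> b; have /hj/ir_exactS[a ha] : exists a, j a = j b by exists b.
  by exists a; apply: (inj_linearP ji); rewrite hq.
by exists h => x; rewrite -hg -hh hq.
Qed.

Lemma ExtE_above_length m : (forall k, (m < k)%N -> forall x : E k, x = 0) ->
  forall n M (u : ExtE n M), (m < n)%N -> u = 0.
Proof.
move=> hE n M u /hE h; have [f fu] := rep_ex u; apply/(rep0 fu)/homE_coboundaryP.
have f0 x : f x = 0 by apply: h.
by case: n u h f {fu} f0 => [|k] u h f f0 //=; exists (\0 : {linear M -> E k}) => x; rewrite f0 raddf0.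
Qed.

Lemma ExtE0_hom (M : lmodType R) (u : ExtE 0 M) : exists2 g : {linear M -> N},
  @represents _ (homE M) 0 (ir_aug E \o g : {linear M -> E 0}) u &
  (forall x, g x = 0) -> u = 0.
Proof.
have [f fu] := rep_ex u; have /homE_cocycle df := rep_cocycle fu.
have [g hg] : exists g : {linear M -> N}, forall x, ir_aug E (g x) = f x.
  by apply: factor_inj => [|x]; [exact: inj_linearI (@ir_aug_inj _ _ E)|apply/ir_exact0].
exists g; last by move=> g0; apply/(rep0 fu)/homE_coboundaryP => x /=; rewrite -hg g0 raddf0.
suff -> : (ir_aug E \o g : {linear M -> E 0}) = f by [].
by apply: Hom_ext.
Qed.

Lemma hom_ExtE0 (M : lmodType R) (g : {linear M -> N}) : exists u : ExtE 0 M,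
  @represents _ (homE M) 0 (ir_aug E \o g : {linear M -> E 0}) u.
Proof. by apply: cocycle_rep; apply/homE_cocycle => x /=; apply/ir_exact0; exists (g x). Qed.

Lemma ExtE0_map_hom (A B : lmodType R) (p : {linear A -> B}) (g : {linear B ->
  N}) u :
  @represents _ (homE B) 0 (ir_aug E \o g : {linear B -> E 0}) u ->
  @represents _ (homE A) 0 (ir_aug E \o (g \o p) : {linear A -> E 0}) (ExtE_map 0 p u).
Proof.
move=> /(ExtE_mapP p); suff -> : Hom_precomp (E 0) p (ir_aug E \o g : {linear B -> E 0}) = 
  (ir_aug E \o (g \o p) : {linear A -> E 0}) by [].
exact: Hom_ext.
Qed.

End ExtInj.

(** * Primes, prime avoidance and local rings *)

Lemma In_cat (X : Type) (x : X) (s t : seq X) :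
  List.In x (s ++ t) <-> List.In x s \/ List.In x t.
Proof. exact: List.in_app_iff. Qed.

Lemma In_split (X : Type) (x : X) (s : seq X) :
  List.In x s -> exists s1 s2, s = s1 ++ x :: s2.
Proof. exact: List.in_split. Qed.

Section Primes.
Variable R : comNzRingType.
Hypothesis nR : noeth_module R^o.
Implicit Types p q I : R -> Prop.

(** This is the nilradical of R / I localized at p: if x lies in every prime
    between I and p, then x is nilpotent there. Clearing denominators by an
    element outside p avoids constructing the localization. *)
Lemma power_at_prime p x I : is_prime p -> is_ideal I ->
  (forall q, is_prime q -> (forall r, I r -> q r) -> (forall r, q r -> p r) -> q x) ->
  exists s k, ~ p s /\ I (s * x ^+ k).
Proof.
move=> hp hI; have [_ p1 _] := hp; move: I hI; apply: (ideal_ind nR).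
- move=> q hq hx; have [qp|] := EM (forall r, q r -> p r).
    exists 1, 1%N; split=> //; rewrite mul1r expr1; exact: hx.
  move=> /existsNP[s /not_implyP[qs ps]]; exists s, 0%N; split=> //.
  by rewrite mulr1.
- move=> I hI I1 _; exists 1, 0%N; split=> //; by rewrite mulr1.
move=> I a hI IHc IHa hx.
have [|s [k [ps hs]]] := IHc.
  by move=> q hq Iq qp; apply: hx => // r Ir; apply: Iq; exact: sub_colon.
have [|t [l [pt [c hc]]]] := IHa.
  by move=> q hq Iq qp; apply: hx => // r Ir; apply: Iq; exact: sub_adjoin.
exists (t * s), (k + l)%N; split; first exact: primeNM.
have -> : t * s * x ^+ (k + l) = s * x ^+ k * (t * x ^+ l - c * a) + c * (s * x ^+ k * a).
  by rewrite exprD; ring.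
by apply: idealD => //; apply: idealM.
Qed.

(** The hypotheses say that z survives in the localization at p and is killed
    there by a power of each element of p. A multiple of z that still survives,
    chosen with maximal annihilator, has annihilator p. *)
Lemma associated_prime (V : lmodType R) (z : V) p : is_prime p ->
  (forall s, ~ p s -> s *: z <> 0) ->
  (forall y, p y -> exists s k, ~ p s /\ (s * y ^+ k) *: z = 0) ->
  exists r, forall t, (t * r) *: z = 0 <-> p t.
Proof.
move=> hp z0 hz; pose F P := exists2 r, P = (fun t => (t * r) *: z = 0) &
  forall s, ~ p s -> (s * r) *: z <> 0.
have [||P [r eP hr] rmax] := @noeth_max R R^o F (fun t => (t * 1) *: z = 0) nR.
- by exists 1 => // s ps; rewrite mulr1; exact: z0.
- move=> P [r hP _]; subst P; split; first by rewrite mul0r scale0r.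
  move=> a x y hx hy; rewrite mulrDl scalerDl hy addr0.
  by rewrite -[_ *: (x : R^o)]/(a * x) -mulrA -scalerA hx scaler0.
have big u : (forall s, ~ p s -> (s * (u * r)) *: z <> 0) ->
    forall t, (t * (u * r)) *: z = 0 -> (t * r) *: z = 0.
  move=> hu t ht; subst P; apply: (rmax (fun t => (t * (u * r)) *: z = 0) _ _ t) => //.
    by exists (u * r).
  by move=> v hv; rewrite mulrCA -scalerA hv scaler0.
subst P; exists r => t; split; first by move=> ht; apply: contrapT => /hr.
move=> pt.
have ex : exists k, `[< exists s, ~ p s /\ (s * t ^+ k * r) *: z = 0 >].
  have [s [k [ps hs]]] := hz _ pt; exists k; apply/asboolP; exists s; split=> //.
  by rewrite mulrC -scalerA hs scaler0.
(* With k + 1 minimal, t^k r z survives; by maximality it has the same annihilator as r z. *)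
case: (ex_minnP ex) => -[|k] /asboolP[s [ps hs]] kmin.
  by case: (hr _ ps); rewrite -hs mulr1.
have sr : (s * t * r) *: z = 0.
  apply: (big (t ^+ k)); last by rewrite -hs exprS !mulrA.
  move=> s' ps' hs'; suff : (k < k)%N by rewrite ltnn.
  by apply: kmin; apply/asboolP; exists s'; split=> //; rewrite -mulrA.
apply: (big s); last by rewrite mulrA [t * s]mulrC.
by move=> s' ps' hs'; apply: (hr (s' * s)); [exact: primeNM|rewrite -mulrA].
Qed.

Lemma scalC (V : lmodType R) a b (v : V) : a *: (b *: v) = b *: (a *: v).
Proof. by rewrite !scalerA mulrC. Qed.

(** Nakayama's lemma over the localization at p, by eliminating one generator
    at a time: the equation of the generator z has pivot t - xc, which is outside
    p. *)
Lemma nakayama_at_prime (V : lmodType R) p x : is_prime p -> p x -> forall s :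
  seq V,
  (forall v, span s v -> exists t v', [/\ ~ p t, span s v' & t *: v = x *: v']) ->
  exists2 w, ~ p w & forall v, span s v -> w *: v = 0.
Proof.
move=> hp px; have [ip p1 _] := hp; elim=> [|z s IH] /= hs.
  by exists 1 => // v ->; rewrite scaler0.
have [t [v' [pt [c hc] tz]]] : exists t v', [/\ ~ p t, span (z :: s) v' & t *: z = x *: v'].
  by apply: hs; exact: (@span_mem _ _ (z :: s) 0%N).
(* With v' = c z + u, the relation t z = x v' becomes (t - x c) z = x u. *)
set u := v' - c *: z in hc.
have pT : ~ p (t - x * c).
  by move=> h; apply: pt; rewrite -[t](subrK (x * c)); apply: idealD => //; exact: idealMr.
have hz : (t - x * c) *: z = x *: u.
  by rewrite scalerBl tz /u scalerBr scalerA.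
have [|w pw hw] := IH.
  move=> v hv; have [|t' [v2 [pt' [c' hc'] hv2]]] := hs v.
    by exists 0; rewrite scale0r subr0.
  set u' := v2 - c' *: z in hc'.
  exists ((t - x * c) * t'), ((c' * x) *: u + (t - x * c) *: u'); split.
  - exact: primeNM.
  - by apply: (span_submodule s).2 => //; apply: (submoduleZ (span_submodule s)).
  rewrite -scalerA hv2 (_ : v2 = c' *: z + u'); last by rewrite /u' addrC subrK.
  by rewrite scalC; congr (_ *: _); rewrite scalerDr [LHS]addrC scalC hz addrC !scalerA.
exists (w * (t - x * c)); first exact: primeNM.
move=> v [r hr]; rewrite -[v](subrK (r *: z)) scalerDr mulrC -scalerA hw //.
rewrite scaler0 add0r -scalerA scalC [(t - _) *: _]scalC hz [r *: _]scalC scalC.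
by rewrite [w *: _]scalC hw // !scaler0.
Qed.

Lemma avoid_product p (ps : seq (R -> Prop)) : is_prime p ->
  (forall q, List.In q ps -> is_ideal q /\ exists2 y, q y & ~ p y) ->
  exists2 y, ~ p y & forall q, List.In q ps -> q y.
Proof.
move=> hp; elim: ps => [|q ps IH] h; first by exists 1 => //; case: hp.
have [|y py hy] := IH; first by move=> q' hq'; apply: h; right.
have [iq [b qb pb]] := h q (or_introl (erefl _)).
exists (b * y); first exact: primeNM.
move=> q' [<-|hq']; first exact: idealMr.
by apply: idealM; [case: (h q' (or_intror hq'))|exact: hy].
Qed.

(** If some q in the list lies in the first prime p it can be dropped, since
    avoiding p avoids q. Otherwise an element x avoiding all other primes but
    lying in p is corrected by a product of elements of I and of the other
    primes that is outside p. *)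
Lemma prime_avoidance I (ps : seq (R -> Prop)) : is_ideal I ->
  (forall q, List.In q ps -> is_prime q /\ exists2 y, I y & ~ q y) ->
  exists2 x, I x & forall q, List.In q ps -> ~ q x.
Proof.
move=> hI; move: {2}(size ps) (erefl (size ps)) => n.
elim: n ps => [|n IH] [|p ps] //= sn h; first by exists 0; [exact: hI.1|].
case: sn => sn; have [hp [b Ib pb]] := h p (or_introl (erefl _)).
have [[q [hq qp]]|noq] := EM (exists q, List.In q ps /\ forall r, q r -> p r).
  have [l1 [l2 e]] := In_split hq; subst ps.
  have [||x Ix hx] := IH (p :: l1 ++ l2).
  - by rewrite /= -sn !size_cat /= addnS.
  - move=> q' [e|/In_cat[h'|h']]; apply: h; first by left.
      by right; apply/In_cat; left.
    by right; apply/In_cat; right; right.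
  exists x => // q' [<-|]; first by apply: hx; left.
  move=> /In_cat[h'|[<-|h']].
  - by apply: hx; right; apply/In_cat; left.
  - by move=> /qp; apply: hx; left.
  by apply: hx; right; apply/In_cat; right.
have [//||x Ix hx] := IH ps; first by move=> q hq; apply: h; right.
have [px|npx] := EM (p x); last first.
  by exists x => // q [<-|] //; exact: hx.
have [|y py hy] := @avoid_product p ps hp.
  move=> q hq; have [[iq _ _] _] := h q (or_intror hq); split=> //.
  apply: contrapT => nq; apply: noq; exists q; split=> // r qr.
  by apply: contrapT => npr; apply: nq; exists r.
have [ip _ _] := hp.
exists (x + y * b); first by apply: idealD => //; exact: idealM.
move=> q [<-|hq] hxy.
  apply: (primeNM hp py pb); rewrite -[y * b](addKr x) addrC; exact: idealB.
apply: (hx q hq); rewrite -[x](addrK (y * b)); have [[iq _ _] _] := h q (or_intror hq).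
by apply: idealB => //; apply: idealMr => //; exact: hy.
Qed.

(** A prime containing I contains either a, hence I + (a), or I : a, because the
    product of I : a and (a) lies in I. *)
Lemma minimal_primes I : is_ideal I -> exists ps : seq (R -> Prop),
  (forall q, List.In q ps -> is_prime q /\ forall r, I r -> q r) /\
  forall p, is_prime p -> (forall r, I r -> p r) ->
    exists2 q, List.In q ps & forall r, q r -> p r.
Proof.
move: I; apply: (ideal_ind nR).
- move=> p hp; exists [:: p]; split; first by move=> q [<-|].
  by move=> q hq pq; exists p => //; left.
- move=> I hI I1; exists [::]; split=> // p [_ p1 _] Ip; by case: p1; apply: Ip.
move=> I a hI [ps [h1 h2]] [qs [h3 h4]]; exists (ps ++ qs); split.
  move=> q /In_cat[/h1|/h3][hq Iq]; split=> // r Ir; apply: Iq.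
    exact: sub_colon.
  exact: sub_adjoin.
move=> p hp Ip; have [ip _ pM] := hp.
have [pa|npa] := EM (p a).
  have [|q hq qp] := h4 p hp; last by exists q => //; apply/In_cat; right.
  by move=> r; apply: adjoin_min.
have [|q hq qp] := h2 p hp; last by exists q => //; apply/In_cat; left.
by move=> r /Ip /pM[].
Qed.

Section Local.
Variable m : R -> Prop.
(** The form in which locality is used: m is prime and its complement consists
    of units. *)
Definition is_local := is_prime m /\ forall s, ~ m s -> exists t, t * s = 1.
Hypothesis lm : is_local.

Lemma local_sub I x : is_ideal I -> ~ I 1 -> I x -> m x.
Proof.
move=> hI I1 Ix; apply: contrapT => /lm.2[t ht]; apply: I1; rewrite -ht; exact: idealM.
Qed.

Lemma local_cancel (V : lmodType R) s (v : V) : ~ m s -> s *: v = 0 -> v = 0.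
Proof. by move=> /lm.2[t ht] h; rewrite -[v]scale1r -ht -scalerA h scaler0. Qed.

Lemma nakayama_local (V : lmodType R) x : fin_spanned V -> m x ->
  (forall v : V, exists v', v = x *: v') -> forall v : V, v = 0.
Proof.
move=> [s hs] mx h v; have [hm m1 _] := lm.1.
have [|w mw hw] := @nakayama_at_prime V m x lm.1 mx s.
  by move=> u _; have [u' hu] := h u; exists 1, u'; rewrite scale1r.
exact: local_cancel mw (hw _ (hs v)).
Qed.

(** The elementwise form of being killed by a power of m; the two agree for a
    finitely generated m, see [max_torsionP]. *)
Definition max_torsion (V : lmodType R) (v : V) :=
  forall y, m y -> exists k, y ^+ k *: v = 0.

Lemma local_nilp I : is_ideal I ->
  (forall q, is_prime q -> (forall r, I r -> q r) -> forall r, m r -> q r) ->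
  forall y, m y -> exists k, I (y ^+ k).
Proof.
move=> hI hq y my; have [|s [k [ms hs]]] := @power_at_prime m y I lm.1 hI.
  by move=> q pq Iq qm; exact: hq.
have [t ht] := lm.2 _ ms; exists k; rewrite -[_ ^+ k]mul1r -ht -mulrA; exact: idealM.
Qed.

(** Choose x outside the finitely many minimal primes of I other than m. A prime
    q containing I + (x) contains one of them properly, unless that minimal prime
    is m; as no chain of three primes exists above I, q is m. *)
Lemma dim1_parameter I : is_ideal I ->
  ~ (exists p q, [/\ is_prime p, is_prime q, forall r, I r -> p r,
     (forall r, p r -> q r) & (exists2 r, q r & ~ p r) /\ exists2 r, m r & ~ q r]) ->
  exists2 x, m x & forall y, m y -> exists k, adjoin I x (y ^+ k).
Proof.
move=> hI dim1; have [ps [h1 h2]] := minimal_primes hI; have [im _ _] := lm.1.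
pose qs := List.filter (fun q => `[< exists2 y, m y & ~ q y >]) ps.
have [|x mx hx] := @prime_avoidance m qs im.
  by move=> q /List.filter_In[/h1[hq _] /asboolP].
exists x => //; apply: local_nilp; first exact: adjoin_ideal.
move=> q hq Iq r mr; apply: contrapT => nqr; have [|p hp pq] := h2 q hq.
  by move=> t It; apply: Iq; exact: sub_adjoin.
have npx : ~ p x.
  apply: hx; apply/List.filter_In; split=> //; apply/asboolP; exists r => //.
  by move=> /pq.
apply: dim1; exists p, q; have [pp Ip] := h1 p hp; split=> //; split.
  by exists x => //; apply: Iq; exact: adjoin_self.
by exists r.
Qed.

(** Apart from copies of R / m, the factors of a prime filtration of R / I are
    domains on which x, being outside the listed primes, acts injectively; so the
    kernel of x on R / I only sees the copies of R / m. *)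
Lemma avoid_torsion I : is_ideal I -> exists ps : seq (R -> Prop),
  (forall q, List.In q ps -> is_prime q /\ exists2 y, m y & ~ q y) /\
  forall x, (forall q, List.In q ps -> ~ q x) -> forall z, I (x * z) ->
    forall y, m y -> exists k, I (y ^+ k * z).
Proof.
move: I; apply: (ideal_ind nR).
- move=> p hp; have [ip p1 pM] := hp.
  have [mp|nmp] := EM (forall r, m r -> p r).
    exists [::]; split=> // x _ z _ y my; exists 1%N; rewrite expr1.
    by apply: idealMr => //; exact: mp.
  exists [:: p]; split.
    move=> q [<-|] //; split=> //.
    by move/existsNP: nmp => [r /not_implyP[mr pr]]; exists r.
  move=> x hx z /pM[px|pz] y my; first by case: (hx p (or_introl (erefl _))).
  by exists 0%N; rewrite mul1r.
- move=> I hI I1; exists [::]; split=> // x _ z _ y _; exists 0%N.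
  by rewrite -[_ * z]mulr1; exact: idealM.
move=> I a hI [ps [h1 h2]] [qs [h3 h4]]; exists (ps ++ qs); split.
  by move=> q /In_cat[/h1|/h3].
move=> x hx z Ixz y my.
have [|k [c hc]] := h4 x (fun q hq => hx q (proj2 (In_cat _ _ _) (or_intror hq))) z _ y my.
  exact: sub_adjoin.
have [|l hl] := h2 x (fun q hq => hx q (proj2 (In_cat _ _ _) (or_introl hq))) c _ y my.
  rewrite /colon; have -> : x * c * a = y ^+ k * (x * z) - x * (y ^+ k * z - c * a) by ring.
  by apply: idealB => //; apply: idealM.
exists (l + k)%N.
have -> : y ^+ (l + k) * z = y ^+ l * (y ^+ k * z - c * a) + y ^+ l * c * a.
  by rewrite exprD; ring.
by apply: idealD => //; apply: idealM.
Qed.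

Lemma max_torsion_socle (V : lmodType R) (v : V) : v <> 0 -> max_torsion v ->
  exists r, forall t, (t * r) *: v = 0 <-> m t.
Proof.
move=> v0 hv; apply: associated_prime; first exact: lm.1.
  by move=> s ms h; apply: v0; exact: local_cancel ms h.
move=> y /hv[k hk]; exists 1, k; rewrite mul1r; split=> //; by case: lm.1.
Qed.

(** The kernel of an x provided by [avoid_torsion] is m-torsion; if it were
    nonzero it would contain a copy of R / m. *)
Lemma regular_exists I : is_ideal I ->
  (forall z, ~ I z -> exists2 y, m y & ~ I (y * z)) ->
  exists2 x, m x & forall z, I (x * z) -> I z.
Proof.
move=> hI hz; have [ps [h1 h2]] := avoid_torsion hI; have [im m1 _] := lm.1.
have [x mx hx] := prime_avoidance im h1; exists x => // z Ixz.
apply: contrapT => nIz; have [C [w [_ hw]]] := cyc_exists hI.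
have [||r hr] := @max_torsion_socle C (z *: w).
- by move=> /hw.
- by move=> y my; have [k hk] := h2 x hx z Ixz y my; exists k; rewrite scalerA; apply/hw.
have [|y my nI] := hz (r * z).
  by move=> Irz; apply: m1; apply/hr; rewrite mul1r scalerA; apply/hw.
by apply: nI; apply/hw; rewrite mulrA -scalerA; apply/hr.
Qed.

End Local.

(** The ideals of scalars r such that m^n kills rv increase with n, hence become
    stationary, say at Q. If Q were proper, R / Q would contain a copy of R / m,
    that is some r outside Q with mr inside Q; then r would be in the next ideal
    of the chain, which is Q. *)
Lemma max_torsionP (mm : {pred R}) (V : lmodType R) (v : V) :
  is_local (fun r => r \in mm) -> max_torsion (fun r => r \in mm) v <-> v \in torsion mm V.
Proof.
move=> lm; split=> [hv|/torsionP[n hn] y my]; last first.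
  exists n; apply: hn; elim: n => [//|n IH]; apply/ideal_mulP.
  exists [:: (y ^+ n, y)]; split; last by rewrite big_seq1 exprSr.
  by move=> uv; rewrite inE => /eqP ->.
apply/torsionP; pose Q n r := {in ideal_exp mm n, forall a, a *: (r *: v) = 0}.
have Qi n : is_ideal (Q n).
  split; first by move=> a _; rewrite scale0r scaler0.
  move=> a x y hx hy b hb; rewrite scalerDl scalerDr hy // addr0.
  by rewrite -scalerA scalerA mulrC -scalerA hx ?scaler0.
have Qinc n r : Q n r -> Q n.+1 r by apply: ideal_exp_kill.
have [k hk] := @noeth_acc R R^o Q nR Qi Qinc; exists k.
suff Q1 : Q k 1 by move=> a /Q1; rewrite scale1r.
apply: contrapT => nQ1; have [C [w hC]] := cyc_exists (Qi k); have [_ hw] := hC.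
have [||r hr] := max_torsion_socle lm (v := w).
- by move=> w0; apply: nQ1; apply/hw; rewrite w0 scaler0.
- move=> y /hv[l hl]; exists l; apply/hw => a _; by rewrite hl scaler0.
have [_ m1 _] := lm.1; apply: m1; apply/hr; rewrite mul1r; apply/hw/(hk k.+1).
move=> _ /ideal_mulP[s [hs ->]]; rewrite scaler_suml big_seq big1 // => -[b c] /hs[/= hb hc].
have /hr /hw : c \in mm by [].
by move=> /(_ _ hb); rewrite -!scalerA.
Qed.

End Primes.

(** * Presentations and separatedness *)

Section Misc.
Variable R : comNzRingType.

Lemma short_exact_of_surj (B C : lmodType R) (p : {linear B -> C}) :
  surj_linear p ->
  exists (A : lmodType R) (i : {linear A -> B}), short_exact i p.
Proof.
move=> ps; have [|A [i [ii hi]]] := @sub_exists R B (fun b => p b = 0).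
  by split=> [|a x y hx hy]; rewrite ?raddf0 // linearP /= hx hy scaler0 addr0.
by exists A, i.
Qed.

Lemma short_exact_of_inj (A B : lmodType R) (i : {linear A -> B}) :
  inj_linear i ->
  exists (C : lmodType R) (p : {linear B -> C}), short_exact i p.
Proof.
move=> ii; have [|C [p [ps hp]]] := @quot_exists R B (fun b => exists a, i a = b).
  split; first by exists 0; exact: raddf0.
  by move=> b _ _ [x <-] [y <-]; exists (b *: x + y); rewrite linearP.
by exists C, p.
Qed.

Lemma scale_mapE (V : lmodType R) a (v : V) : scale_map V a v = a *: v.
Proof. by []. Qed.

Lemma cyc_fin_spanned I (C : lmodType R) (z : C) : cyc I z -> fin_spanned C.
Proof.
by move=> [gen _]; exists [:: z] => c; have [r ->] := gen c; exists r; rewrite subrr.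
Qed.

Lemma projective_regular : projective (R^o : lmodType R).
Proof.
move=> A B p g ps; have [a pa] := ps (g 1); have [h hh] := orbit_map a.
exists h => x; rewrite hh linearZ /= pa -linearZ /=; congr (g _); exact: mulr1.
Qed.

(** Writing w = x^j z_j gives z_j = x z_(j+1) since x is regular. The increasing
    submodules R z_j become stationary, so z_(k+1) = r x z_(k+1) for some k, and
    1 - rx is a unit. *)
Lemma krull_separated (V : lmodType R) (m : R -> Prop) x (w : V) :
  is_local m -> m x -> noeth_module V -> (forall v : V, x *: v = 0 -> v = 0) ->
  (forall j, exists v, w = x ^+ j *: v) -> w = 0.
Proof.
move=> lm mx nV reg /choice[z hz].
have regX j (v : V) : x ^+ j *: v = 0 -> v = 0.
  by elim: j v => [|j IH] v; rewrite ?scale1r // exprSr -scalerA => /IH/reg.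
have zS j : z j = x *: z j.+1.
  apply/subr0_eq/(regX j).
  by rewrite scalerBr -hz scalerA -exprSr -hz subrr.
have [||k hk] := @noeth_acc R V (fun j v => exists r, v = r *: z j) nV.
- move=> j; split; first by exists 0; rewrite scale0r.
  by move=> a _ _ [r ->] [t ->]; exists (a * r + t); rewrite scalerDl scalerA.
- by move=> j _ [r ->]; rewrite zS scalerA; exists (r * x).
have [|r hr] := hk k.+1 (z k.+1); first by exists 1; rewrite scale1r.
have [im m1 _] := lm.1.
rewrite (hz k.+1) (_ : z k.+1 = 0) ?scaler0 //.
apply: (local_cancel lm (s := 1 - r * x)).
  by move=> h; apply: m1; rewrite -[1](subrK (r * x)); apply: idealD => //; exact: idealM.
by rewrite scalerBl scale1r -scalerA -zS -hr subrr.
Qed.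

End Misc.

(** * Vanishing of Ext for a ring of finite injective dimension *)

Section Gorenstein.
Variables (R : comNzRingType) (m : R -> Prop) (E : injective_resolution (R^o : lmodType R)).
Hypotheses (nR : noeth_module R^o) (lm : is_local m).

Definition ExtE_zero i (M : lmodType R) := forall u : ExtE E i M, u = 0.

Lemma ExtE_zero_module i (M : lmodType R) : (forall v : M, v = 0) ->
  ExtE_zero i M.
Proof.
move=> h u; rewrite -[u]scale1r -(@ExtE_map_scale _ _ E i M (scale_map M 0) 1).
  by rewrite (@ExtE_map_scale _ _ E i M (scale_map M 0) 0) ?scale0r.
by move=> x; rewrite [x]h !raddf0.
Qed.

Lemma ExtE_killed i I (M : lmodType R) : killed I M -> killed I (ExtE E i M).
Proof.
move=> kM r u Ir; rewrite -(@ExtE_map_scale _ _ E i M (scale_map M r)) //.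
rewrite (@ExtE_map_scale _ _ E i M (scale_map M r) 0) ?scale0r // => x.
by rewrite scale0r; exact: kM.
Qed.

(** The source of all vanishing by factorization: if T^i(X) = 0, then a kills
    T^i(M). *)
Lemma ExtE_map_factor i (M X : lmodType R) (f : {linear M -> X}) (g :
  {linear X -> M}) a :
  (forall v, g (f v) = a *: v) -> forall u, a *: u = ExtE_map E i f (ExtE_map E i g u).
Proof.
move=> h u; rewrite -(@ExtE_map_comp _ _ E i _ _ _ f g (scale_map M a)).
  by rewrite (@ExtE_map_scale _ _ E i M (scale_map M a) a).
by move=> x; rewrite h.
Qed.

Lemma ExtE0_generator : exists e : ExtE E 0 (R^o : lmodType R),
  (forall u, exists r, u = r *: e) /\ forall r, r *: e = 0 -> r = 0.
Proof.
have [e he] := @hom_ExtE0 _ _ E R^o idfun; exists e.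
pose idaug : homE E R^o 0 := (ir_aug E \o idfun : {linear R^o -> E 0}).
have repZ r : @represents _ (homE E R^o) 0 (r *: idaug) (r *: e).
  have [z z0] := @cocycle_rep _ (homE E R^o) 0 0 (raddf0 _).
  have z_0 : z = 0 by apply/(rep0 z0).
  by have := rep_linear r he z0; rewrite z_0 !addr0.
split=> [u|r re].
  have [g gu _] := ExtE0_hom u; exists (g 1); apply: rep_uniq gu _.
  have <- : g 1 *: idaug =
      (ir_aug E \o g : {linear R^o -> E 0}); last exact: repZ.
  apply: Hom_ext => x /=; rewrite -linearZ /=; congr (ir_aug E _).
  have -> : g x = x * g 1 by rewrite -[x in LHS]mulr1 -[LHS]/(g (x *: 1)) linearZ.
  exact: mulrC.
have h0 := repZ r; rewrite re in h0.
have /homE_coboundaryP/(_ 1)/= := proj1 (rep0 h0) (erefl _).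
rewrite -linearZ /= [_ *: _]mulr1 => h; apply: (@ir_aug_inj _ _ E).
by rewrite h raddf0.
Qed.

Lemma ExtE_zero_ext_closed i : ext_closed (ExtE_zero i).
Proof.
move=> A B C f p s zA zC u.
have /(ExtE_exact_middle s)[v <-] : ExtE_map E i f u = 0 by exact: zA.
by rewrite [v]zC raddf0.
Qed.

(** Induction on i. For R / I, T^(i+1)(R / I) is a quotient of T^i(I) because
    T^(i+1)(R) = 0, and T^0(R / I) embeds in T^0(R), which is R. *)
Lemma ExtE_noeth i (M : lmodType R) : fin_spanned M -> noeth_module (ExtE E i M).
Proof.
elim: i M => [|i IH] M hM; apply: (@fin_spanned_ind R (fun M => noeth_module (ExtE E _ M)) (fun=> False)) hM _ => //.
- by move=> A B C f p s nA nC; exact: (noeth_exact (@ExtE_exact_middle _ _ E _ _ _ _ _ s _) nC nA).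
- move=> I hI _ C z [gen hz]; have [p hp] := orbit_map z.
  have ps : surj_linear p by move=> c; have [r ->] := gen c; exists r.
  have [K [j s]] := short_exact_of_surj ps.
  apply: noeth_inj (ExtE0_map_inj s) _.
  have [e [eg _]] := ExtE0_generator; have [g hg] := orbit_map e.
  by apply: noeth_surj (nR) => u; have [r ->] := eg u; exists r.
- by move=> A B C f p s nA nC; exact: (noeth_exact (@ExtE_exact_middle _ _ E _ _ _ _ _ s _) nC nA).
move=> I hI _ C z [gen hz]; have [p hp] := orbit_map z.
have ps : surj_linear p by move=> c; have [r ->] := gen c; exists r.
have [K [j s]] := short_exact_of_surj ps; have [d [_ hd]] := ExtE_connecting E s i.
apply: (@noeth_surj _ _ _ d); last first.
  by apply: IH; apply: noeth_fin_spanned; case: s => ji _ _; apply: noeth_inj ji nR.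
move=> u; apply/hd; apply: ExtE_projective; exact: projective_regular.
Qed.

(** Multiplication by x is onto on T^i(W) since the next term T^(i+1)(W / xW) is
    zero, so Nakayama's lemma applies. *)
Lemma ExtE_zero_of_regular i (W : lmodType R) x : fin_spanned W -> m x ->
  (forall w : W, x *: w = 0 -> w = 0) ->
  (forall (D : lmodType R) (p : {linear W -> D}), short_exact (scale_map W x) p -> ExtE_zero i.+1 D) ->
  ExtE_zero i W.
Proof.
move=> hW mx reg hD; have [D [p s]] := short_exact_of_inj (reg : inj_linear (scale_map W x)).
have [d [hd _]] := ExtE_connecting E s i.
have fT : fin_spanned (ExtE E i W) by apply/noeth_fin_spanned/ExtE_noeth.
apply: (nakayama_local lm fT mx) => u.
have /hd[v <-] : d u = 0 by apply: (hD D p s).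
by exists v; apply: ExtE_map_scale.
Qed.

Definition ExtE_residue_zero i := forall (C : lmodType R) (z : C), cyc m z ->
  ExtE_zero i C.

(** By devissage only R / p matters: for p = m this is the hypothesis on the
    residue field, and otherwise some x in m is regular on R / p. *)
Lemma ExtE_zero_descend i : (forall M : lmodType R, fin_spanned M ->
  ExtE_zero i.+1 M) -> ExtE_residue_zero i ->
  forall M : lmodType R, fin_spanned M -> ExtE_zero i M.
Proof.
move=> h hk M hM; apply: (@devissage R (ExtE_zero i) (fun=> False)) hM _ => //.
- exact: ExtE_zero_ext_closed.
- by move=> V; exact: ExtE_zero_module.
move=> p hp _ C z hC; have [ip p1 pM] := hp; have [gen hz] := hC.
have [mp|] := EM (forall r, m r -> p r).
  apply: (hk C z); apply: cyc_ext hC => r; split; last exact: mp.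
  by apply: (local_sub lm).
move=> /existsNP[x /not_implyP[mx px]]; apply: (@ExtE_zero_of_regular _ _ x) => //.
- exact: cyc_fin_spanned hC.
- move=> w; have [r ->] := gen w; rewrite scalerA => /hz /pM[//|pr].
  exact/hz.
move=> D q [_ qs _]; apply: h; apply: fin_spanned_surj qs _; exact: cyc_fin_spanned hC.
Qed.

(** The descent from the length of E has to stop, since T^0(R) is R. *)
Lemma top_index_exists : (exists b, forall k, (b < k)%N -> forall x :
  E k, x = 0) ->
  exists n, (forall i (M : lmodType R), (n < i)%N -> fin_spanned M -> ExtE_zero i M) /\ ~ ExtE_residue_zero n.
Proof.
move=> [b hb].
have ex : exists j, `[< forall i (M : lmodType R), (j <= i)%N -> fin_spanned M -> ExtE_zero i M >].
  by exists b.+1; apply/asboolP => i M bi _ u; exact: ExtE_above_length hb _ _ u bi.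
case: (ex_minnP ex) => -[|n] /asboolP hn nmin.
  have [e [_ he]] := ExtE0_generator; case/eqP: (oner_neq0 R); apply: he.
  rewrite [e](hn 0%N) ?scaler0 //; exists [:: 1] => v; exists v.
  by rewrite [_ *: _]mulr1 subrr.
exists n; split=> // hk; suff : (n < n)%N by rewrite ltnn.
apply: nmin; apply/asboolP => i M; rewrite leq_eqVlt => /orP[/eqP <-|]; last exact: hn.
by apply: ExtE_zero_descend hk _ => M'; exact: hn.
Qed.

Variable n : nat.
Hypothesis vanish_above : forall i (M : lmodType R), (n < i)%N ->
  fin_spanned M -> ExtE_zero i M.
Hypothesis residue_top : ~ ExtE_residue_zero n.

(** T^n is right exact because T^(n+1) = 0, so T^n(L) maps onto T^n(R / m) for
    every L containing R / m. *)
Lemma top_nonzero_of_socle (L : lmodType R) (v : L) : fin_spanned L ->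
  (forall r, r *: v = 0 <-> m r) -> ~ ExtE_zero n L.
Proof.
move=> hL hv zL; apply: residue_top => C z hC u; have [A [i [w [ii iw hA]]]] := cyc_sub v.
have {}hA : cyc m w by apply: cyc_ext hA.
have [D [p s]] := short_exact_of_inj ii.
have zA : ExtE_zero n A.
  move=> t; have [d [hd _]] := ExtE_connecting E s n.
  have /hd[t' <-] : d t = 0.
    apply: vanish_above => //; case: s => _ ps _; exact: fin_spanned_surj ps hL.
  by rewrite [t']zL raddf0.
have [f fz] := @cyc_map R m _ _ z w hC (fun r => proj2 (hA.2 r)).
have [g gw] := @cyc_map R m _ _ w z hA (fun r => proj2 (hC.2 r)).
rewrite -[u]scale1r (@ExtE_map_factor n _ _ f g 1) ?[ExtE_map E n g u]zA ?raddf0 // => c.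
by have [r ->] := hC.1 c; rewrite !linearZ /= fz gw scale1r.
Qed.

(** Ext of R / J against R is concentrated in degree s, where it is a cyclic
    module with annihilator J, as for the Koszul resolution of a regular sequence. *)
Definition perfect_grade s (J : R -> Prop) := forall (C : lmodType R) (z :
  C), cyc J z ->
  (forall j, j != s -> ExtE_zero j C) /\
  exists e : ExtE E s C, (forall u, exists r, u = r *: e) /\ forall r, r *: e = 0 -> J r.

Lemma cyc_killed J (C : lmodType R) (z : C) : cyc J z -> killed J C.
Proof.
move=> hC r c Jr; have [t ->] := hC.1 c; rewrite scalerA; apply/hC.2.
by apply: idealMr => //; exact: cyc_ideal hC.
Qed.

(** In the sequence R / J --x--> R / J --> R / (J + (x)) the action of x on
    T^s(R / J) = R / J is injective, and its cokernel R / (J + (x)) becomes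
    T^(s+1). *)
Lemma perfect_grade_step s J x : is_ideal J -> perfect_grade s J ->
  (forall r, J (x * r) -> J r) ->
  perfect_grade s.+1 (adjoin J x).
Proof.
move=> hJ pJ reg D w hD; have [C [z hC]] := cyc_exists hJ.
have [zC [e [eg e0]]] := pJ C z hC.
have [|p pz] := @cyc_map R J _ _ z w hC.
  by move=> r Jr; apply/hD.2; exact: sub_adjoin.
have sxp : short_exact (scale_map C x) p.
  split.
  - move=> c; have [r ->] := hC.1 c; rewrite scale_mapE scalerA => /hC.2/reg ?; exact/hC.2.
  - by move=> d; have [r ->] := hD.1 d; exists (r *: z); rewrite linearZ /= pz.
  move=> c; have [r ->] := hC.1 c; rewrite linearZ /= pz; split.
    move=> /hD.2[t]; rewrite -hC.2 scalerBl => /subr0_eq ->.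
    by exists (t *: z); rewrite scale_mapE scalerA mulrC.
  move=> [c' h]; have [t ct] := hC.1 c'; rewrite ct scale_mapE in h.
  by apply/hD.2; exists t; apply/hC.2; rewrite scalerBl -h scalerA mulrC subrr.
have pj0 j (u : ExtE E j D) : ExtE_map E j p u = 0.
  have [js|js] := eqVneq j s; last exact: zC.
  subst j; have [r hr] := eg (ExtE_map E s p u); rewrite hr.
  apply: (ExtE_killed (cyc_killed hC)); apply: reg; apply: e0.
  rewrite -scalerA -hr -linearZ /=.
  by rewrite (ExtE_killed (cyc_killed hD)) ?raddf0 //; exact: adjoin_self.
split.
  case=> [|j] js u; first exact: (ExtE0_map_inj sxp (pj0 _ _)).
  have [d [_ hd]] := ExtE_connecting E sxp j; have /hd[v <-] := pj0 _ u.
  by rewrite [v]zC ?raddf0.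
have [d [hd hd']] := ExtE_connecting E sxp s; exists (d e); split=> [u|r].
  have /hd'[v <-] := pj0 _ u; have [r ->] := eg v; exists r; exact: linearZ.
rewrite -linearZ => /hd[v]; rewrite (ExtE_map_scale (a := x)) //.
have [t ->] := eg v => h; exists t; apply: e0.
by rewrite scalerBl mulrC -scalerA h subrr.
Qed.

(** The second component is the ideal generated by the sequence. *)
Inductive regseq : nat -> (R -> Prop) -> Prop :=
| regseq0 : regseq 0 (fun r => r = 0)
| regseqS s J x : regseq s J -> m x -> (forall r, J (x * r) -> J r) ->
    regseq s.+1 (adjoin J x).

Lemma zero_ideal : is_ideal (fun r : R => r = 0).
Proof. by split=> [//|a x y -> ->]; rewrite scaler0 addr0. Qed.

Lemma regseq_ideal s J : regseq s J -> is_ideal J.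
Proof.
by elim=> [|s' J' x _ hJ _ _]; [exact: zero_ideal|exact: adjoin_ideal].
Qed.

Lemma regseq_sub s J r : regseq s J -> J r -> m r.
Proof.
have [im _ _] := lm.1; move=> h; elim: h r => [r ->|s' J' x _ hJ mx _ r]; first exact: im.1.
by apply: adjoin_min.
Qed.

Lemma ExtE_zero_cyc_iso i J (C D : lmodType R) (z : C) (w : D) : cyc J z ->
  cyc J w ->
  ExtE_zero i C -> ExtE_zero i D.
Proof.
move=> hC hD zC u.
have [f fz] := @cyc_map R J _ _ z w hC (fun r => proj2 (hD.2 r)).
have [g gw] := @cyc_map R J _ _ w z hD (fun r => proj2 (hC.2 r)).
rewrite -[u]scale1r (@ExtE_map_factor i _ _ g f 1) ?[ExtE_map E i f u]zC ?raddf0 // => c.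
by have [r ->] := hD.1 c; rewrite !linearZ /= gw fz scale1r.
Qed.

Lemma regseq_perfect_grade s J : regseq s J -> perfect_grade s J.
Proof.
elim=> [|s' J' x hr hJ mx reg]; last by apply: perfect_grade_step => //; exact: regseq_ideal hr.
have hR : cyc (fun r : R => r = 0) (1 : R^o).
  by split=> [c|r]; [exists c|]; rewrite [_ *: _]mulr1.
move=> C z hC; split.
  case=> // j _; apply: (ExtE_zero_cyc_iso hR hC) => u; apply: ExtE_projective; exact: projective_regular.
have [f fz] := @cyc_map R _ _ _ _ z hR (fun r => proj2 (hC.2 r)).
have [g gw] := @cyc_map R _ _ _ z _ hC (fun r => proj2 (hR.2 r)).
have [e [eg e0]] := ExtE0_generator.
have fgK r u : r *: u = ExtE_map E 0 g (ExtE_map E 0 f (r *: u)).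
  rewrite -(@ExtE_map_factor 0 _ _ g f 1) ?scale1r // => c.
  by have [t ->] := hC.1 c; rewrite !linearZ /= gw fz scale1r.
have gfK u : u = ExtE_map E 0 f (ExtE_map E 0 g u).
  rewrite -(@ExtE_map_factor 0 _ _ f g 1) ?scale1r // => c.
  by have [t ->] := hR.1 c; rewrite !linearZ /= fz gw scale1r.
exists (ExtE_map E 0 g e); split=> [u|r h].
  have [r hr] := eg (ExtE_map E 0 f u); exists r.
  by rewrite -[u]scale1r fgK scale1r hr linearZ.
by apply: e0; rewrite [_ *: _]gfK linearZ /= h raddf0.
Qed.

(** If no element of m were regular modulo J, then R / m would embed in R / J, so
    that T^n(R / J) <> 0, against concentration in degree s < n. *)
Lemma regseq_exists s : (s <= n)%N -> exists J, regseq s J.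
Proof.
elim: s => [|s IH] hs; first by exists (fun r => r = 0); exact: regseq0.
have [J hJ] := IH (ltnW hs); have iJ := regseq_ideal hJ; have [_ m1 _] := lm.1.
have [|x mx reg] := regular_exists nR lm iJ; last by exists (adjoin J x); exact: regseqS.
move=> z Jz; apply: contrapT => nz; have [C [w hC]] := cyc_exists iJ.
apply: (@top_nonzero_of_socle C (z *: w)); first exact: cyc_fin_spanned hC.
  move=> r; rewrite scalerA hC.2; split=> [Jrz|mr].
    apply: contrapT => mr; apply: Jz; apply/hC.2; apply: (local_cancel lm mr).
    by rewrite scalerA; apply/hC.2.
  by apply: contrapT => nJ; apply: nz; exists r.
by apply: (proj1 (regseq_perfect_grade hJ hC)); rewrite neq_ltn hs orbT.
Qed.

(** With k such that J : x^k is stationary, x is regular on R / (J : x^k), hence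
    T^n vanishes there; multiplication by x^k on R / J factors through that
    module, and T^n(R / J) has annihilator J. *)
Lemma regseq_radical J x : regseq n J -> m x -> exists k, J (x ^+ k).
Proof.
move=> hJ mx; have iJ := regseq_ideal hJ.
have [||k hk] := @noeth_acc R R^o (fun k => colon J (x ^+ k)) nR.
- by move=> k; exact: colon_ideal.
- by move=> k r; rewrite /colon exprSr mulrA => h; exact: idealMr.
have [C [z hC]] := cyc_exists iJ; have [D [w hD]] := cyc_exists (colon_ideal (x ^+ k) iJ).
have [f fz] : exists f : {linear C -> D}, f z = w.
  by apply: cyc_map hC _ => r Jr; apply/hD.2; exact: sub_colon.
have [g gw] : exists g : {linear D -> C}, g w = x ^+ k *: z.
  by apply: cyc_map hD _ => r Jr; rewrite scalerA; apply/hC.2.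
have zD : ExtE_zero n D.
  apply: (@ExtE_zero_of_regular _ _ x) => //; first exact: cyc_fin_spanned hD.
    move=> v; have [r ->] := hD.1 v; rewrite scalerA => /hD.2 h; apply/hD.2.
    by apply: (hk k.+1); move: h; rewrite /colon exprS mulrA [x * r]mulrC.
  move=> D' p [_ ps _]; apply: vanish_above => //; apply: fin_spanned_surj ps _; exact: cyc_fin_spanned hD.
exists k; have [_ [e [_ e0]]] := regseq_perfect_grade hJ hC; apply: e0.
rewrite (@ExtE_map_factor n _ _ f g) ?[ExtE_map E n g e]zD ?raddf0 // => c.
by have [r ->] := hC.1 c; rewrite !linearZ /= fz gw scalerA mulrC -scalerA.
Qed.

(** For a finitely generated module over a noetherian local ring this is
    equivalent to having finite length. *)
Definition finite_length (M : lmodType R) := fin_spanned M /\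
  forall y, m y -> exists k, forall v : M, y ^+ k *: v = 0.

Lemma ExtE_zero_finite_length i (M : lmodType R) : ExtE_residue_zero i ->
  finite_length M -> ExtE_zero i M.
Proof.
move=> hk [hM hy].
apply: (@devissage R (ExtE_zero i) (fun r => forall v : M, r *: v = 0)) hM _ => //.
- exact: ExtE_zero_ext_closed.
- by move=> V; exact: ExtE_zero_module.
move=> p hp Ip C z hC; apply: (hk C z); apply: cyc_ext hC => r.
have [ip p1 _] := hp; split; first exact: (local_sub lm).
by move=> /hy[k hk']; apply: (primeX hp (k := k)); apply: Ip.
Qed.

Lemma finite_length_inj (A B : lmodType R) (i : {linear A -> B}) :
  inj_linear i -> finite_length B -> finite_length A.
Proof.
move=> ii [hB hy]; split; first by apply/noeth_fin_spanned/(noeth_inj ii)/fin_spanned_noeth.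
by move=> y /hy[k hk]; exists k => v; apply: ii; rewrite linearZ /= hk.
Qed.

(** Induction on i: R / m is a quotient of R / J, for a regular sequence of length
    n, with kernel of finite length, and T^i(R / J) = 0. *)
Lemma low_vanish i : (i < n)%N -> ExtE_residue_zero i.
Proof.
have [J hJ] := regseq_exists (leqnn n); have iJ := regseq_ideal hJ.
have [C [z hC]] := cyc_exists iJ; have [zC _] := regseq_perfect_grade hJ hC.
have fC : finite_length C.
  split; first exact: cyc_fin_spanned hC.
  move=> y my; have [k hk] := regseq_radical hJ my; exists k => v; exact: (cyc_killed hC).
elim: i => [|i IH] hi D w hD u.
all: have [p pz] : exists p : {linear C -> D}, p z = w
  by apply: cyc_map hC _ => r Jr; apply/hD.2; exact: regseq_sub hJ Jr.
all: have ps : surj_linear p by move=> d; have [r ->] := hD.1 d; exists (r *: z); rewrite linearZ /= pz.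
all: have [K [j s]] := short_exact_of_surj ps.
  by apply: (ExtE0_map_inj s); apply: zC; rewrite neq_ltn hi.
have [d [_ hd]] := ExtE_connecting E s i.
have /hd[v <-] : ExtE_map E i.+1 p u = 0 by apply: zC; rewrite neq_ltn hi.
rewrite [v](ExtE_zero_finite_length (IH (ltnW hi))) ?raddf0 //.
by apply: finite_length_inj fC; case: s => ji _ _; exact: ji.
Qed.

End Gorenstein.

(** * Krull dimension and injective dimension *)

Section Chains.
Variable R : comNzRingType.

Definition prime_tower d (c : nat -> R -> Prop) :=
  (forall i, (i <= d)%N -> is_prime (c i)) /\
  forall i, (i < d)%N -> (forall r, c i r -> c i.+1 r) /\ exists2 r, c i.+1 r & ~ c i r.

Lemma chain_below d c q : prime_tower d c -> is_prime q -> (forall r, q r ->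
  c 0%N r) ->
  (exists2 r, c 0%N r & ~ q r) -> exists c', prime_tower d.+1 c'.
Proof.
move=> [hc hs] hq qc nq; exists (fun i => if i is j.+1 then c j else q).
by split=> -[|i] //=; [exact: hc|exact: hs].
Qed.

Lemma chain_insert d c i q : prime_tower d c -> (i < d)%N -> is_prime q ->
  (forall r, c i r -> q r) -> (exists2 r, q r & ~ c i r) ->
  (forall r, q r -> c i.+1 r) -> (exists2 r, c i.+1 r & ~ q r) ->
  exists c', prime_tower d.+1 c'.
Proof.
move=> [hc hs] id hq cq ncq qc nqc.
exists (fun j => if (j <= i)%N then c j else if j == i.+1 then q else c j.-1); split=> j hj.
  case: leqP => ij; first by apply: hc; apply: leq_trans ij (ltnW id).
  case: eqVneq => // _; apply: hc; by case: j hj {ij}.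
have [ji|] := ltnP j i; first by rewrite (ltnW ji); apply: hs; exact: ltn_trans ji id.
rewrite leq_eqVlt => /orP[/eqP <-|ij]; first by rewrite leqnn eqxx.
rewrite leqNgt ij /= eqSS (gtn_eqF ij).
case: eqVneq ij => [-> _ //|ji1 ij].
by case: j hj ij ji1 => // j hj ij _; apply: hs.
Qed.

End Chains.

Section Gorenstein.
Variables (R : comNzRingType) (m : R -> Prop) (E : injective_resolution (R^o : lmodType R)).
Hypotheses (nR : noeth_module R^o) (lm : is_local m).
Variable n : nat.
Hypothesis vanish_above : forall i (M : lmodType R), (n < i)%N ->
  fin_spanned M -> ExtE_zero E i M.
Hypothesis residue_top : ~ ExtE_residue_zero m E n.

(** A nonzero divisor modulo J lies in no minimal prime of J, so below any prime
    containing J + (x) there is a prime containing J but not x. *)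
Lemma regseq_prime_tower s J p : regseq m s J -> is_prime p ->
  (forall r, J r -> p r) ->
  exists2 c, prime_tower s c & c s = p.
Proof.
move=> h; elim: h p => [|s' J' x hJ IH mx reg] p hp Jp.
  by exists (fun=> p).
have iJ := regseq_ideal hJ.
have [q [hq Jq qp nqx]] : exists q, [/\ is_prime q, forall r, J' r -> q r,
    forall r, q r -> p r & ~ q x].
  apply: contrapT => nq; have [|t [k [pt hs]]] := @power_at_prime R nR p x J' hp iJ.
    by move=> q hq Jq qp; apply: contrapT => qx; apply: nq; exists q.
  apply: pt; apply: Jp; apply: sub_adjoin; elim: k hs => [|k IHk]; first by rewrite mulr1.
  by rewrite exprS mulrCA => /reg.
have [c [hc hs] cq] := IH q hq Jq.
exists (fun i => if (i <= s')%N then c i else p); last by rewrite ltnn.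
split=> i hi; first by case: leqP => // ?; exact: hc.
rewrite -ltnS hi; case: (ltnP i s') => his; first exact: hs.
have -> : i = s' by apply/eqP; rewrite eqn_leq his -ltnS hi.
rewrite cq; split=> //; exists x => //; apply: Jp; exact: adjoin_self.
Qed.

(** T^i(R / p) stays nonzero after localizing at p: since p kills it, the class u
    has annihilator exactly p. *)
Definition has_generic_class p i := exists (C : lmodType R) (z : C) (u :
  ExtE E i C),
  cyc p z /\ forall r, r *: u = 0 -> p r.

(** A minimal prime p is the annihilator of some r in R, so R / p embeds in R by
    1 |-> r; the restriction to R / p of the generator of T^0(R) has annihilator p. *)
Lemma bass_start p : is_prime p ->
  (forall q, is_prime q -> (forall r, q r -> p r) -> forall r, p r -> q r) -> has_generic_class p 0.
Proof.
move=> hp pmin; have [ip p1 _] := hp.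
have [||r hr] := @associated_prime R nR R^o 1 p hp.
- by move=> s ps; rewrite [_ *: _]mulr1 => s0; apply: ps; rewrite s0; exact: ip.1.
- move=> y py; have [|s [k [ps hs]]] := @power_at_prime R nR p y _ hp (zero_ideal R).
    by move=> q hq _ qp; exact: pmin.
  by exists s, k; split=> //; rewrite hs scale0r.
have [A [j [w [ji jw hA]]]] := cyc_sub (r : R^o).
have {}hA : cyc p w.
  by apply: cyc_ext hA => t; rewrite -hr [in X in _ <-> X]/GRing.scale /= mulr1.
have [e [_ e0]] := ExtE0_generator E; have [f hf] := orbit_map w.
exists A, w, (ExtE_map E 0 j e); split=> // t ht; apply/hr.
have -> : t * r = 0; last by rewrite scale0r.
apply: e0; rewrite -scalerA (@ExtE_map_factor _ E 0 _ _ f j r); last first.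
  by move=> v; rewrite hf linearZ /= jw; exact: mulrC.
by rewrite -linearZ /= ht raddf0.
Qed.

(** If T^(i+1)(R / q) vanished after localizing at q, then so would T^(i+1) of
    R / (p + (x)), whose prime factors inside q can only be q by adjacency. So x
    would act surjectively on the localization of T^i(R / p) at q, which would
    then be zero by Nakayama's lemma, contradicting the class with annihilator p. *)
Lemma bass_step i p q x : is_prime p -> is_prime q -> (forall r, p r -> q r) ->
  q x -> ~ p x ->
  (forall p', is_prime p' -> (forall r, p r -> p' r) -> p' x -> (forall r, p' r -> q r) ->
     forall r, q r -> p' r) ->
  has_generic_class p i -> has_generic_class q i.+1.
Proof.
move=> hp hq pq qx px adj [C [z [u [hC hu]]]]; apply: contrapT => ng.
have [ip p1 pM] := hp; have [iq q1 qM] := hq.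
have reg : inj_linear (scale_map C x).
  by move=> c; have [r ->] := hC.1 c; rewrite scale_mapE scalerA => /hC.2/pM[//|pr]; apply/hC.2.
have [D [pi s]] := short_exact_of_inj reg; have [_ pis ex] := s.
pose Phi (M : lmodType R) := forall v : ExtE E i.+1 M, exists2 s, ~ q s & s *: v = 0.
have PhiD : Phi D.
  apply: (@devissage R Phi (fun r => p r \/ r = x)) => //.
  - move=> A B C' f g sfg PA PC v; have [t qt ht] := PA (ExtE_map E i.+1 f v).
    have /(ExtE_exact_middle sfg)[v' hv'] : ExtE_map E i.+1 f (t *: v) = 0 by rewrite linearZ.
    have [t' qt' ht'] := PC v'; exists (t' * t); first exact: primeNM.
    by rewrite -scalerA -hv' -linearZ /= ht' raddf0.
  - by move=> V V0 v; exists 1 => //; rewrite scale1r; exact: ExtE_zero_module.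
  - move=> p' hp' Ip' C' z' hC'.
    have [p'q|] := EM (forall r, p' r -> q r); last first.
      move=> /existsNP[t /not_implyP[p't qt]] v; exists t => //.
      by apply: (ExtE_killed (cyc_killed hC')).
    have qp' := adj p' hp' (fun r pr => Ip' r (or_introl pr)) (Ip' x (or_intror (erefl _))) p'q.
    move=> v; apply: contrapT => nv; apply: ng; exists C', z', v; split.
      by apply: cyc_ext hC' => r; split; [exact: p'q|exact: qp'].
    by move=> r rv; apply: contrapT => qr; apply: nv; exists r.
  - by apply: fin_spanned_surj pis _; exact: cyc_fin_spanned hC.
  move=> r d [pr| ->]; have [c <-] := pis d; rewrite -linearZ /=.
    by rewrite (cyc_killed hC) ?raddf0.
  by apply/ex; exists c.
have [d [hd _]] := ExtE_connecting E s i.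
have [g hg] : fin_spanned (ExtE E i C) by apply/noeth_fin_spanned/(ExtE_noeth nR)/(cyc_fin_spanned hC).
have [|w qw hw] := @nakayama_at_prime R (ExtE E i C) q x hq qx g.
  move=> v _; have [t qt ht] := PhiD (d v).
  have /hd[v' hv'] : d (t *: v) = 0 by rewrite linearZ.
  by exists t, v'; split=> //; rewrite -hv'; apply: ExtE_map_scale.
by apply: qw; apply: pq; apply: hu; exact: hw.
Qed.

(** A chain of maximal length is saturated and starts at a minimal prime, as
    [bass_start] and [bass_step] require. *)
Lemma dim_eq d : (exists c : nat -> R -> Prop, prime_tower d c) ->
  (forall k (c : nat -> R -> Prop), prime_tower k c -> (k <= d)%N) -> d = n.
Proof.
move=> [c hc] dmax; have [hcp hcs] := hc.
apply/eqP; rewrite eqn_leq; apply/andP; split; last first.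
  have [J hJ] := regseq_exists nR lm vanish_above residue_top (leqnn n).
  have [c' hc' _] := regseq_prime_tower hJ lm.1 (fun r => regseq_sub lm hJ).
  exact: dmax hc'.
have gen i : (i <= d)%N -> has_generic_class (c i) i.
  elim: i => [|i IH] hi.
    apply: bass_start; first exact: hcp.
    move=> q hq qc r cr; apply: contrapT => qr.
    have [||c' /dmax] := chain_below hc hq; [by []|by exists r|by rewrite ltnn].
  have [ci [x cx ncx]] := hcs i hi.
  apply: (@bass_step i (c i) (c i.+1) x) => //; [exact/hcp/ltnW|exact: hcp| |exact/IH/ltnW].
  move=> q hq cq qx qc r cr; apply: contrapT => qr.
  have [c' /dmax] := chain_insert hc hi hq cq (ex_intro2 _ _ x qx ncx) qc (ex_intro2 _ _ r cr qr).
  by rewrite ltnn.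
have [C [z [u [hC hu]]]] := gen d (leqnn d); rewrite leqNgt; apply/negP => nd.
have [_ c1 _] := hcp d (leqnn d); apply: c1; apply: hu.
by rewrite [u](vanish_above nd (cyc_fin_spanned hC)) scaler0.
Qed.

End Gorenstein.

(** * Torsion at the maximal ideal *)

Section Torsion.
Variables (R : comNzRingType) (m : R -> Prop).
Hypotheses (nR : noeth_module R^o) (lm : is_local m).

Lemma max_torsion_weak (V : lmodType R) (v : V) :
  (forall y, m y -> exists k, max_torsion m (y ^+ k *: v)) -> max_torsion m v.
Proof.
move=> h y my; have [k /(_ y my)[l hl]] := h y my.
by exists (l + k)%N; rewrite exprD -scalerA.
Qed.

Lemma max_torsionZ (V : lmodType R) a (v : V) : max_torsion m v ->
  max_torsion m (a *: v).
Proof. by move=> h y /h[k hk]; exists k; rewrite scalC hk scaler0. Qed.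

Lemma max_torsion_submodule (V : lmodType R) : submodule (@max_torsion R m V).
Proof.
split; first by move=> y _; exists 0%N; rewrite scaler0.
move=> a v w hv hw y my; have [k hk] := hv y my; have [l hl] := hw y my.
exists (k + l)%N; rewrite scalerDr [in X in X + _]addnC !exprD -!scalerA.
by rewrite (scalC _ a v) hk hl !scaler0 addr0.
Qed.

Lemma max_torsion_map (U V : lmodType R) (f : {linear U -> V}) u :
  max_torsion m u -> max_torsion m (f u).
Proof. by move=> h y /h[k hk]; exists k; rewrite -linearZ /= hk raddf0. Qed.

Lemma max_torsion_inj (U V : lmodType R) (f : {linear U -> V}) u : inj_linear f ->
  max_torsion m (f u) -> max_torsion m u.
Proof. by move=> fi h y /h[k hk]; exists k; apply: fi; rewrite linearZ. Qed.

Lemma finite_length_of_torsion (V : lmodType R) : noeth_module V -> (forall v :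
  V, max_torsion m v) -> finite_length m V.
Proof.
move=> nV h; split; first exact: noeth_fin_spanned.
move=> y my; have [||k hk] := @noeth_acc R V (fun k v => y ^+ k *: v = 0) nV.
- by move=> k; split=> [|a v w hv hw]; rewrite ?scaler0 // scalerDr scalC hv hw scaler0 addr0.
- by move=> k v hv; rewrite exprS -scalerA hv scaler0.
by exists k => v; have [l hl] := h v y my; exact: hk hl.
Qed.

(** Phrased through the action on M: some power of y lies in Ann M + (x). *)
Definition parameter_for (M : lmodType R) x := m x /\
  forall y, m y -> exists k c, forall v : M, y ^+ k *: v = (c * x) *: v.

Lemma parameter_pow (M : lmodType R) x j y : parameter_for M x -> m y ->
  exists k c, forall v : M, y ^+ k *: v = c *: (x ^+ j *: v).
Proof.
move=> [_ hx] /hx[k [c h]]; exists (k * j)%N, (c ^+ j) => v.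
rewrite scalerA -exprMn exprM; elim: j v => [|j IH] v; first by rewrite !expr0.
by rewrite [in LHS]exprSr [in RHS]exprSr -[LHS]scalerA -[RHS]scalerA h IH.
Qed.

Lemma torsion_free_quotient (M : lmodType R) x : parameter_for M x ->
  exists (G N : lmodType R) (i : {linear G -> M}) (p : {linear M -> N}),
    [/\ short_exact i p, forall v, p v = 0 <-> max_torsion m v, forall g : G, max_torsion m g &
        forall w : N, x *: w = 0 -> w = 0].
Proof.
move=> hx; have [G [i [ii hi]]] := sub_exists (max_torsion_submodule M).
have [N [p [ps hp]]] := quot_exists (max_torsion_submodule M).
exists G, N, i, p; split=> //.
- by split=> // v; rewrite hp hi.
- by move=> g; apply: (max_torsion_inj ii); apply/hi; exists g.
move=> w; have [v <-] := ps w; rewrite -linearZ /= => /hp h; apply/hp.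
apply: max_torsion_weak => y my; have [k [c hv]] := parameter_pow 1 hx my; exists k.
by rewrite hv expr1; exact: max_torsionZ.
Qed.

Lemma parameter_surj (M N : lmodType R) (p : {linear M -> N}) x : surj_linear p ->
  parameter_for M x -> parameter_for N x.
Proof.
move=> ps [mx hx]; split=> // y /hx[k [c h]]; exists k, c => w.
by have [v <-] := ps w; rewrite -!linearZ /= h.
Qed.

End Torsion.

(** * Duality for modules of finite length *)

Section Duality.
Variables (R : comNzRingType) (m : R -> Prop) (E : injective_resolution (R^o : lmodType R)).
Hypotheses (nR : noeth_module R^o) (lm : is_local m).
Variable n : nat.
Hypothesis vanish_above : forall i (M : lmodType R), (n.+2 < i)%N ->
  fin_spanned M -> ExtE_zero E i M.
Hypothesis residue_top : ~ ExtE_residue_zero m E n.+2.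

Let low i (M : lmodType R) : (i < n.+2)%N -> finite_length m M -> ExtE_zero E i M.
Proof. by move=> hi; apply: ExtE_zero_finite_length => //; exact: low_vanish hi. Qed.

(** Let A be the image of multiplication by a on L. T^n(L) maps onto T^n(A), and
    T^n(A) embeds in T^n(L); the composite is multiplication by a, which is 0. So
    T^n(A) = 0, and A, having finite length, is 0. *)
Lemma top_faithful (L : lmodType R) a : finite_length m L ->
  (forall u : ExtE E n.+2 L, a *: u = 0) -> forall v : L, a *: v = 0.
Proof.
move=> fL ha; have [A [i [ii hi]]] : exists (A : lmodType R) (i : {linear A -> L}),
    inj_linear i /\ forall v, (exists w, v = a *: w) <-> exists b, i b = v.
  apply: sub_exists; split; first by exists 0; rewrite scaler0.
  by move=> b _ _ [v ->] [w ->]; exists (b *: v + w); rewrite scalerDr scalC.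
have [q hq] : exists q : {linear L -> A}, forall v, i (q v) = scale_map L a v.
  by apply: factor_inj ii _ => v; apply/hi; exists v.
have qs : surj_linear q.
  move=> b; have /hi[w hw] : exists b', i b' = i b by exists b.
  by exists w; apply: (inj_linearP ii); rewrite hq.
have fA := finite_length_inj nR ii fL.
have zA : ExtE_zero E n.+2 A.
  move=> t; have [D [p s]] := short_exact_of_inj ii; have [d [hd _]] := ExtE_connecting E s n.+2.
  have /hd[t' <-] : d t = 0.
    apply: vanish_above => //; case: s => _ ps _; exact: fin_spanned_surj ps fL.1.
  have [K [j s']] := short_exact_of_surj qs.
  have [d' [_ hd']] := ExtE_connecting E s' n.+1.
  have /hd'[w <-] : ExtE_map E n.+2 q (ExtE_map E n.+2 i t') = 0.
    by rewrite -(@ExtE_map_factor _ E n.+2 _ _ q i a).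
  rewrite [w]low ?raddf0 //; case: s' => ji _ _; exact: finite_length_inj ji fL.
move=> v; rewrite -[_ *: _]hq; suff -> : q v = 0 by rewrite raddf0.
apply: contrapT => qv; have [|r hr] := max_torsion_socle nR lm qv.
  by move=> y my; have [k hk] := fA.2 y my; exists k.
by apply: (top_nonzero_of_socle vanish_above residue_top fA.1 (v := r *: q v)) zA => t; rewrite scalerA.
Qed.

(** Here n + 2 is the top degree, so that the degree n below both degrees of
    interest makes sense; T^n and T^(n+1) vanish on the torsion of M. *)
Lemma ann_top_minus_one (M : lmodType R) x a : fin_spanned M ->
  parameter_for m M x ->
  (forall u : ExtE E n.+1 M, a *: u = 0) <-> forall v : M, max_torsion m (a *: v).
Proof.
move=> hM hx; have nM := fin_spanned_noeth nR hM; have [mx _] := hx.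
have [G [N [i [p [s hp hG reg]]]]] := torsion_free_quotient hx; have [ii ps ex] := s.
have fG : finite_length m G by apply: finite_length_of_torsion => //; exact: noeth_inj ii nM.
split=> ha; last first.
  have [g hg] : exists g : {linear M -> G}, forall v, i (g v) = scale_map M a v.
    by apply: factor_inj ii _ => v; apply/ex/hp; exact: ha.
  by move=> u; rewrite (@ExtE_map_factor _ E n.+1 _ _ g i a) // [ExtE_map E _ i u]low ?raddf0.
have nN := noeth_surj ps nM.
have haN (u : ExtE E n.+1 N) : a *: u = 0.
  have [d [_ hd]] := ExtE_connecting E s n.
  have /hd[w <-] : ExtE_map E n.+1 p (a *: u) = 0 by rewrite linearZ /= ha.
  by rewrite [w]low ?raddf0.
move=> v; apply/hp/(krull_separated lm mx nN reg) => j.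
have regX : inj_linear (scale_map N (x ^+ j)).
  move=> w; rewrite scale_mapE; elim: (j) => [|k IH]; first by rewrite scale1r.
  by rewrite exprS -scalerA => /reg.
have [L [q s']] := short_exact_of_inj regX; have [_ qs exq] := s'.
have fL : finite_length m L.
  split; first exact: fin_spanned_surj qs (noeth_fin_spanned nN).
  move=> y my; have [k [c h]] := parameter_pow j (parameter_surj ps hx) my; exists k => l.
  have [w <-] := qs l; rewrite -linearZ /= h; apply/exq; exists (c *: w).
  by rewrite scale_mapE scalC.
have zN : ExtE_zero E n.+2 N.
  apply: (ExtE_zero_of_regular nR lm (noeth_fin_spanned nN) mx reg) => D pi [_ pis _].
  by apply: vanish_above => //; exact: fin_spanned_surj pis (noeth_fin_spanned nN).
have haL (u : ExtE E n.+2 L) : a *: u = 0.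
  have [d [_ hd]] := ExtE_connecting E s' n.+1; have /hd[w <-] : ExtE_map E n.+2 q u = 0 by exact: zN.
  by rewrite -linearZ /= haN raddf0.
have /exq[w hw] : q (p (a *: v)) = 0.
  by rewrite 2!linearZ /= (top_faithful fL haL).
by exists w; rewrite -hw.
Qed.

End Duality.

(** * The first local cohomology module *)

Lemma ann_cohomology (R : comNzRingType) (C : cochain_complex R) n a :
  (forall u : cohomology C n.+1, a *: u = 0) <->
  forall f : C n.+1, cc_diff C n.+1 f = 0 -> exists g, a *: f = cc_diff C n g.
Proof.
have repZ (f : C n.+1) u : represents f u -> represents (a *: f) (a *: u).
  move=> fu; have [z z0] := @cocycle_rep _ C n.+1 0 (raddf0 _).
  have z_0 : z = 0 by apply/(rep0 z0); exists 0; rewrite raddf0.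
  by have := rep_linear a fu z0; rewrite z_0 !addr0.
split=> h.
  by move=> f /cocycle_rep[u fu]; apply/(rep0 (repZ _ _ fu)).
move=> u; have [f fu] := rep_ex u; apply/(rep0 (repZ _ _ fu)).
exact/h/(rep_cocycle fu).
Qed.

Section LocalCohomology.
Variables (R : comNzRingType) (mm : {pred R}).
Let m : R -> Prop := fun r => r \in mm.
Hypotheses (nR : noeth_module R^o) (lm : is_local m).

Let tors (V : lmodType R) (v : V) : max_torsion m v <-> v \in torsion mm V.
Proof. exact: (max_torsionP nR v lm). Qed.

(** A class is given by y in I^0 whose differential is torsion, and a kills it if
    and only if ay lies in M + Gamma_m(I^0). *)
Lemma ann_H1 (M : lmodType R) (I : injective_resolution M) x a : fin_spanned M ->
  parameter_for m M x ->
  (forall u : local_cohomology mm I 1, a *: u = 0) <-> forall v : M, max_torsion m (a *: v).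
Proof.
move=> hM hx; have nM := fin_spanned_noeth nR hM; have [mx _] := hx.
have augi : inj_linear (ir_aug I) by exact: inj_linearI (@ir_aug_inj _ _ I).
rewrite (ann_cohomology (gamma_complex mm I)); split=> h; last first.
  move=> f /(congr1 val) /= df.
  have /ir_exactS[y dy] : ir_diff I 1 (val f) = 0 by [].
  have ft : max_torsion m (val f) by apply/tors; exact: (valP f).
  have ay : a *: y \in torsion mm (I 0).
    apply/tors; apply: max_torsion_weak => y' my'.
    have [k hk] := ft y' my'; exists k.
    have /ir_exact0[v hv] : ir_diff I 0 (y' ^+ k *: y) = 0 by rewrite linearZ /= dy.
    by rewrite scalC -hv -linearZ; exact: max_torsion_map.
  by exists (exist _ (a *: y) ay : Gamma mm (I 0)); apply: val_inj; rewrite /= linearZ /= dy.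
move=> u.
have [||K hK] := @noeth_acc R M (fun k v => x ^+ k *: v = 0) nM.
- by move=> k; split=> [|b v w hv hw]; rewrite ?scaler0 // scalerDr scalC hv hw scaler0 addr0.
- by move=> k v hv; rewrite exprS -scalerA hv scaler0.
(* x^K kills whatever any power of x kills, so x^j v |-> x^K v is well defined. *)
have key j : exists b, max_torsion m (a *: (x ^+ K *: u) - x ^+ j *: b).
  have [A [i [ii hi]]] : exists (A : lmodType R) (i : {linear A -> M}),
    inj_linear i /\ forall v, (exists w, v = x ^+ j *: w) <-> exists b, i b = v.
    apply: sub_exists; split; first by exists 0; rewrite scaler0.
    by move=> b _ _ [v ->] [w ->]; exists (b *: v + w); rewrite scalerDr scalC.
  have [q hq] : exists q : {linear M -> A}, forall v, i (q v) = scale_map M (x ^+ j) v.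
    by apply: factor_inj ii _ => v; apply/hi; exists v.
  have qs : surj_linear q.
    move=> b; have /hi[w hw] : exists b', i b' = i b by exists b.
    by exists w; apply: (inj_linearP ii); rewrite hq.
  have [|g hg] := factor_surj (f := ir_aug I \o scale_map M (x ^+ K) : {linear M -> I 0}) qs.
    by move=> b qb /=; rewrite (hK j b) ?raddf0 // -[_ *: _]hq qb raddf0.
  have [h' hh'] := ir_inj g (inj_linearP ii).
  have hxj v : h' (x ^+ j *: v) = ir_aug I (x ^+ K *: v).
    by rewrite -[_ *: _ in LHS]hq hh' hg.
  pose y := h' u.
  have daug v : ir_diff I 0 (ir_aug I v) = 0 by apply/ir_exact0; exists v.
  have dyt : ir_diff I 0 y \in torsion mm (I 1).
    apply/tors => y' my'; have [k [c hk]] := parameter_pow j hx my'.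
    exists k; rewrite -linearZ -linearZ /= hk linearZ /= hxj linearZ /= daug scaler0 //.
  have [|w /(congr1 val) /= hw] := h (exist _ (ir_diff I 0 y) dyt : Gamma mm (I 1)).
    by apply: val_inj => /=; apply/ir_exactS; exists y.
  have /ir_exact0[b hb] : ir_diff I 0 (a *: y - val w) = 0.
    by rewrite linearB linearZ /= hw subrr.
  exists b; apply: (max_torsion_inj augi); rewrite linearB [ir_aug I (a *: _)]linearZ.
  rewrite [ir_aug I (x ^+ j *: b)]linearZ /= hb -hxj linearZ /= scalerBr [a *: _]scalC opprB addrC subrK.
  by apply: max_torsionZ; apply/tors; exact: (valP w).
have [G [N [i [p [s hp hG reg]]]]] := torsion_free_quotient hx; have [ii ps ex] := s.
have nN := noeth_surj ps nM.
have : p (a *: (x ^+ K *: u)) = 0.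
  apply: (krull_separated lm mx nN reg) => j; have [b /hp] := key j.
  by rewrite linearB => /subr0_eq ->; exists (p b); rewrite linearZ.
rewrite scalC linearZ /= => hK0; apply/hp; move: hK0.
elim: (K) => [|k IH]; first by rewrite scale1r.
by rewrite exprS -scalerA => /reg.
Qed.

End LocalCohomology.

(** * Comparison with projective resolutions *)

Section Balance.
Variables (R : comNzRingType) (N : lmodType R) (E : injective_resolution N).

(** T^1(X) is the cokernel of Hom(F, N) --> Hom(K, N). *)
Lemma ann_ExtE1 (K F X : lmodType R) (j : {linear K -> F}) (p : {linear F ->
  X}) a :
  short_exact j p -> projective F -> (forall u : ExtE E 1 X, a *: u = 0) <->
  forall f : {linear K -> N}, exists g : {linear F -> N}, forall x, g (j x) = a *: f x.
Proof.
move=> s hF; have [d [hd hd']] := ExtE_connecting E s 0.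
have augi := @ir_aug_inj _ _ E.
split=> h.
  move=> f; have [u fu] := hom_ExtE0 E f.
  have /hd[w hw] : d (a *: u) = 0 by rewrite linearZ /= h.
  have [g gw _] := ExtE0_hom w; have := ExtE0_map_hom j gw; rewrite hw => gu.
  have [z z0] := @cocycle_rep _ (homE E K) 0 0 (raddf0 _).
  have z_0 : z = 0 by apply/(rep0 z0).
  have := rep_linear a fu z0; rewrite z_0 !addr0 => fau.
  have := rep_linear (-1) gu fau; rewrite [- 1 *: (a *: u)]scaleN1r addNr => h0.
  have /homE_coboundaryP /= h1 := proj1 (rep0 h0) (erefl _).
  exists g => x; apply: augi; have := h1 x; rewrite /= scaleN1r linearZ /=.
  by rewrite addrC => /subr0_eq.
move=> u; have /hd'[w <-] : ExtE_map E 1 p u = 0 by exact: ExtE_projective.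
have [f fw _] := ExtE0_hom w; have [g hg] := h f; have [w' gw'] := hom_ExtE0 E g.
rewrite -linearZ; apply/hd; exists w'.
have [z z0] := @cocycle_rep _ (homE E K) 0 0 (raddf0 _).
have z_0 : z = 0 by apply/(rep0 z0).
have := rep_linear a fw z0; rewrite z_0 !addr0 => faw.
apply: rep_uniq (ExtE0_map_hom j gw') _.
suff <- : a *: ((ir_aug E \o f : {linear K -> E 0}) : homE E K 0) =
  (ir_aug E \o (g \o j) : {linear K -> E 0}) by [].
by apply: Hom_ext => x /=; rewrite hg linearZ.
Qed.

Lemma ann_ExtE_shift i (K F X : lmodType R) (j : {linear K -> F}) (p :
  {linear F -> X}) a :
  short_exact j p -> projective F ->
  (forall u : ExtE E i.+2 X, a *: u = 0) <-> forall u : ExtE E i.+1 K, a *: u = 0.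
Proof.
move=> s hF; have [d [hd hd']] := ExtE_connecting E s i.+1; split=> h u.
  have /hd[w <-] : d (a *: u) = 0 by rewrite linearZ /= h.
  by rewrite [w]ExtE_projective ?raddf0.
have /hd'[w <-] : ExtE_map E i.+2 p u = 0 by exact: ExtE_projective.
by rewrite -linearZ /= h raddf0.
Qed.

(** Induction on the degree, replacing M by the first syzygy K of P and P by its
    truncation; the base case compares cocycles on P_1 with maps on K. *)
Lemma ann_Ext_balance i (M : lmodType R) (P : projective_resolution M) a :
  (forall u : Ext P N i.+1, a *: u = 0) <-> forall u : ExtE E i.+1 M, a *: u = 0.
Proof.
elim: i M P => [|i IH] M P.
all: have [K [j s]] := short_exact_of_surj (@pr_aug_surj _ _ P); have [ji _ ex] := s.
all: have [q hq] : exists q : {linear P 1 -> K}, forall v, j (q v) = pr_diff P 0 v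
  by apply: factor_inj ji _ => v; apply/ex/pr_exact0; exists v.
all: have qs : surj_linear q by move=> k;
  have /pr_exact0[v hv] : pr_aug P (j k) = 0 by [apply/ex; exists k];
  exists v; apply: (inj_linearP ji); rewrite hq.
all: have q0 v : q v = 0 <-> exists y, pr_diff P 1 y = v by
  rewrite -pr_exactS -hq; split=> [->|/ji //]; rewrite raddf0.
  rewrite (ann_cohomology (hom_complex P N)) (ann_ExtE1 _ s (@pr_proj _ _ P 0)); split=> h f.
    have [|g hg] := h (f \o q : {linear P 1 -> N}).
      by apply: Hom_ext => x /=; rewrite (proj2 (q0 _)) ?raddf0 //; exists x.
    exists (g : {linear P 0 -> N}) => x; have [v <-] := qs x.
    by rewrite hq; have := congr1 (fun g : Hom _ _ => (g : P 1 -> N) v) hg => /= ->.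
  move=> df; have [|f' hf'] := factor_surj (f := f : {linear P 1 -> N}) qs.
    move=> b /q0[y <-]; exact: (congr1 (fun g : Hom (P 2) N => g y) df).
  have [g hg] := h f'; exists (g : Hom (P 0) N); apply: Hom_ext => x /=.
  by rewrite -hq hg hf'.
pose P' := @ProjectiveResolution R K (fun k => P k.+1) (fun k => pr_diff P k.+1) q
  (fun k => @pr_proj _ _ P k.+1) qs q0 (fun k => @pr_exactS _ _ P k.+1).
rewrite (ann_ExtE_shift _ _ s (@pr_proj _ _ P 0)) -(IH K P').
by rewrite (ann_cohomology (hom_complex P N)) (ann_cohomology (hom_complex P' N)).
Qed.

End Balance.

(** * Ideals as boolean and as propositional predicates *)

Section Interface.
Variable R : comNzRingType.

Lemma noetherian_noeth_module : noetherian R -> noeth_module R^o.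
Proof.
move=> nR P hP; pose I : {pred R} := [pred x | `[< P x >]].
have [|s hs] := nR I.
  split; first by apply/asboolP; exact: hP.1.
  by move=> a x y /asboolP px /asboolP py; apply/asboolP; exact: hP.2.
exists s => v; rewrite spanP; split=> [pv|/hs /asboolP //].
by apply/hs/asboolP.
Qed.

Definition predP (I : {pred R}) : R -> Prop := fun r => r \in I.

Lemma idealr_closedP (I : {pred R}) :
  idealr_closed I <-> is_ideal (predP I) /\ ~ predP I 1.
Proof.
split=> [[I0 I1 IM]|[[I0 IM] /negP I1]].
  by split; [split=> // a x y; exact: IM|exact/negP].
by split=> // a x y; exact: IM.
Qed.

Lemma prime_idealP (p : {pred R}) : prime_ideal p <-> is_prime (predP p).
Proof.
split=> [[/idealr_closedP[ip p1] pM]|[ip p1 pM]].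
  by split=> // a b /pM/orP.
by split; [exact/idealr_closedP|move=> a b /pM/orP].
Qed.

Lemma local_ringP (m : {pred R}) : noeth_module R^o -> local_ring m ->
  is_local (predP m).
Proof.
move=> nR [[/idealr_closedP[im m1] mmax] muniq].
have pred_of (I : R -> Prop) : is_ideal I -> ~ I 1 ->
    exists2 J : {pred R}, idealr_closed J & forall r, r \in J <-> I r.
  move=> hI I1; exists ([pred r | `[< I r >]] : {pred R}); last by move=> r; split=> /asboolP.
  apply/idealr_closedP; split; last by move=> /asboolP.
  split; first by apply/asboolP; exact: hI.1.
  by move=> a x y /asboolP hx /asboolP hy; apply/asboolP; exact: hI.2.
have max_out a : ~ predP m a -> adjoin (predP m) a 1.
  move=> ma; apply: contrapT => n1; have [J hJ JP] := pred_of _ (adjoin_ideal a im) n1.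
  apply: ma; rewrite /predP -(mmax J hJ); first by apply/JP; exact: adjoin_self.
  by move=> r mr; apply/JP; exact: sub_adjoin.
split; first split=> //.
  move=> a b mab; have [ma|/max_out[c mc]] := EM (predP m a); [by left|right].
  rewrite -[b](subrK (c * a * b)) -{1}[b]mul1r -mulrBl -mulrA.
  by apply: idealD => //; [exact: idealMr|exact: idealM].
move=> s ms; apply: contrapT => ns; pose J0 := adjoin (fun r => r = 0) s.
have J01 : ~ J0 1 by move=> [t /subr0_eq h]; apply: ns; exists t.
have [||J [hJ J1 sJ] Jmax] := @noeth_max R R^o (fun J => [/\ is_ideal J, ~ J 1 & forall r, J0 r -> J r]) J0 nR.
- by split=> //; exact: adjoin_ideal (zero_ideal R).
- by move=> P [].
have [I hI IJ] := pred_of _ hJ J1.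
have hmax : maximal_ideal I.
  split=> // K /idealr_closedP[hK K1] IK r; apply/idP/idP => [Kr|/IK //]; apply/IJ.
  by apply: (Jmax (predP K)) => [|v /IJ/IK|] //; split=> // t /sJ/IJ/IK.
apply: ms; rewrite /predP -(muniq I hmax); apply/IJ/sJ/adjoin_self; exact: zero_ideal.
Qed.

Lemma prime_tower_le_dim (I : {pred R}) d : dim_mod_ideal I d ->
  forall k (c : nat -> R -> Prop), prime_tower k c -> (forall r, r \in I -> c 0%N r) -> (k <= d)%N.
Proof.
move=> [_ hmax] k c [hc hs] Ic; apply: (hmax k (fun i => [pred r | `[< c i r >]] : {pred R})).
have mono i : (i <= k)%N -> forall r, r \in I -> c i r.
  elim: i => [//|i IH] hi r /(IH (ltnW hi)); exact: (hs i hi).1.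
have toPE i : predP [pred r | `[< c i r >]] = c i.
  by apply: funext => r; apply: propext; split=> /asboolP.
split=> i hi.
  split; first by apply/prime_idealP; rewrite toPE; exact: hc.
  by move=> r Ir; apply/asboolP; exact: mono hi r Ir.
have [sub [r cr ncr]] := hs i hi; split.
  by move=> t /asboolP /sub h; apply/asboolP.
by move=> /(_ r) h; apply: ncr; apply/asboolP/h/asboolP.
Qed.

Lemma prime_tower_of_dim (I : {pred R}) d : dim_mod_ideal I d -> exists c :
  nat -> R -> Prop, prime_tower d c.
Proof.
move=> [[c [hc hs]] _]; exists (fun i => predP (c i)); split=> i hi.
  by have [/prime_idealP] := hc i hi.
have [sub nsub] := hs i hi; split; first exact: sub.
by apply: contrapT => h; apply: nsub => r cr; apply: contrapT => ncr; apply: h; exists r.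
Qed.

Lemma parameter_exists (m : {pred R}) (M : lmodType R) :
  noeth_module R^o -> is_local (predP m) -> module_dim M 1 -> exists x, parameter_for (predP m) M x.
Proof.
move=> nR lm hM; pose I r := forall v : M, r *: v = 0.
have iI : is_ideal I.
  split=> [v|a x y hx hy v]; first by rewrite scale0r.
  by rewrite scalerDl -scalerA hx hy scaler0 addr0.
have [|x mx hx] := dim1_parameter nR lm iI.
  move=> [p [q [hp hq Ip pq [npq nqm]]]]; have [iq q1 _] := hq.
  suff : (2 <= 1)%N by [].
  apply: (prime_tower_le_dim hM (c := fun i => if i is 0 then p else if i is 1 then q else predP m)).
    split; first by case=> [|[|i]] // _; exact: lm.1.
    by case=> [|[|i]] //= _; split=> // r; exact: (local_sub lm iq q1).
  by move=> r /asboolP; exact: Ip.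
by exists x; split=> // y /hx[k [c hk]]; exists k, c => v; apply/subr0_eq; rewrite -scalerBl hk.
Qed.

End Interface.

Theorem proposition6p4 (R : comNzRingType) (m : {pred R}) (d : nat)
    (M : lmodType R)
    (hR : gorenstein_local_ring m) (hdim : ring_dim R d) (hd : (1 < d)%N)
    (hM : fin_gen M) (hM1 : module_dim M 1) :
  (forall P : projective_resolution M,
     Ann (Ext P R^o d.-1) =i Ann (quotmod (torsion m M))) /\
  (forall I : injective_resolution M,
     Ann (local_cohomology m I 1) =i Ann (quotmod (torsion m M))).
Proof.
have [/noetherian_noeth_module nR hloc [E [b hb]]] := hR.
have lm := local_ringP nR hloc.
have [x hx] := parameter_exists nR lm hM1.
move/fin_genP: hM => fM.
have annE a : a \in Ann (quotmod (torsion m M)) <-> forall v : M, max_torsion (predP m) (a *: v).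
  split=> [/asboolP h v|h].
    apply/(max_torsionP nR _ lm)/quotmod_pi0.
    rewrite -quotmod_scale_pi; exact: h.
  apply/asboolP => u; rewrite -[u]quotmod_reprK.
  rewrite (_ : _ *: _ = quotmod_pi (torsion m M) (a *: quotmod_repr u)); last exact: quotmod_scale_pi.
  by apply/quotmod_pi0/(max_torsionP nR _ lm).
have AnnE (V : lmodType R) a : a \in Ann V <-> forall u : V, a *: u = 0.
  by split=> /asboolP.
have iff_eqb (b1 b2 : bool) : (b1 <-> b2) -> b1 = b2 by move=> h; apply/idP/idP => /h.
have [n [vanish_above residue_top]] : exists n, (forall i (V : lmodType R), (n < i)%N -> fin_spanned V -> ExtE_zero E i V) /\
    ~ ExtE_residue_zero (predP m) E n by apply: top_index_exists => //; exists b.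
have dn : d = n.
  apply: (dim_eq nR lm vanish_above residue_top (prime_tower_of_dim hdim)) => k c hc.
  apply: (prime_tower_le_dim hdim hc) => r /eqP ->; have [h _] := hc; have [[h0 _] _ _] := h 0%N isT.
  exact: h0.
split=> [P|I] a; apply: iff_eqb; rewrite AnnE annE; last exact: (ann_H1 nR lm _ _ fM hx).
case: d hd dn hdim => [|[|d]] // _ dn _; subst n; rewrite (ann_Ext_balance E).
exact: (ann_top_minus_one nR lm vanish_above residue_top _ fM hx).
Qed.
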